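(* Let $q$ be a prime power and let $m$ be an even positive integer. Then $\mathcal{E}_{(q,m)}$ is a cyclic code over $\mathbb{F}_q$ with parameters $[q^{2m}-1,\; m^2+2m+1,\; q^{2m-2}(q^2-q-1)-1]$, and its weight distribution is given by the following list of (Hamming weight, frequency) pairs, where $f_j$ is as defined in the context: \begin{itemize} \item weight $0$, frequency $1$; \item weight $q^{2m}-1$, frequency $q-1$; \item weight $q^{2m}-q^{2m-1}$, frequency $q^{2m}-1+\sum_{j=1}^{m}(q^{2m}-q^{2j})f_j$; \item weight $q^{2m}-q^{2m-1}-1$, frequency $(q-1)\left(q^{2m}-1+\sum_{j=1}^{m}(q^{2m}-q^{2j})f_j\right)$; \item for each $1\le j\le m$: weight $q^{2m}-q^{2m-1}-(-1)^jq^{2m-j-1}(q-1)$, frequency $\bigl(q^{2j-1}+(-1)^jq^{j-1}(q-1)\bigr)f_j$; \item for each $1\le j\le m$: weight $q^{2m}-q^{2m-1}-1-(-1)^jq^{2m-j-1}(q-1)$, frequency $\bigl(q^{2j-1}-(-1)^jq^{j-1}\bigr)(q-1)f_j$; \item for each $1\le j\le m$: weight $q^{2m}-q^{2m-1}+(-1)^jq^{2m-j-1}$, frequency $\bigl(q^{2j-1}-(-1)^jq^{j-1}\bigr)(q-1)f_j$; \item for each $1\le j\le m$: weight $q^{2m}-q^{2m-1}-1+(-1)^jq^{2m-j-1}$, frequency $\bigl(q^{2j}-q^{2j-1}+(-1)^jq^{j-1}\bigr)(q-1)f_j$. \end{itemize}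
   Context: An $[n,k,d]$ code over $\mathbb{F}_q$ is a $k$-dimensional subspace of $\mathbb{F}_q^n$ with minimum Hamming distance $d$. Vectors $(c_0,\dots,c_{n-1})\in\mathbb{F}_q^n$ are identified with $c_0+c_1x+\cdots+c_{n-1}x^{n-1}\in\mathbb{F}_q[x]/(x^n-1)$; a cyclic code is an ideal $\langle g(x)\rangle$ with $g$ monic dividing $x^n-1$, and $(x^n-1)/g(x)$ is its parity-check polynomial. The weight distribution records the number $A_w$ of codewords of each Hamming weight $w$; $A_w$ is the sum of the frequencies of all listed entries whose weight equals $w$ (and $0$ if there are none). Definition of $\mathcal{E}_{(q,m)}$ for even $m$: let $s=2m$, $n=q^s-1$, $t=m/2$, let $\pi$ be a generator of $\mathbb{F}_{q^s}^*$, and for an integer $u$ let $h_u(x)$ be the minimal polynomial of $\pi^{-u}$ over $\mathbb{F}_q$. Let $\Gamma=\{1\}\cup\{q^{2i-1}+1:1\le i\le t\}$ and $h(x)=\prod_{u\in\Gamma}h_u(x)$. Then $\mathcal{E}_{(q,m)}$ is the cyclic code of length $n$ over $\mathbb{F}_q$ with parity-check polynomial $h(x)(x-1)$. The numbers $f_j$: $f_0=1$ and, for $1\le j\le m$, $$f_j=\left(\prod_{i=0}^{j-1}\frac{(-q)^m-(-q)^i}{(-q)^j-(-q)^i}\right)\prod_{\ell=0}^{j-1}\left((-1)^{m+1}q^m+(-1)^{\ell+1}q^{\ell}\right).$$ *)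

(* Defs.v *)
From HB Require Import structures.
From mathcomp Require Import all_boot all_order all_algebra all_field.

Set Implicit Arguments.
Unset Strict Implicit.
Unset Printing Implicit Defensive.

Import Order.TTheory GRing.Theory Num.Theory.
Local Open Scope ring_scope.

Section LinearCodes.

Variables (F : finFieldType) (n : nat).
Implicit Types (c : 'rV[F]_n) (C : {vspace 'rV[F]_n}).

Definition hamming_weight c : nat := #|[set i : 'I_n | c 0 i != 0]|.

Definition hamming_dist c c' : nat := #|[set i : 'I_n | c 0 i != c' 0 i]|.

Definition min_distance C (d : nat) : Prop :=
  (exists c c', [/\ c \in C, c' \in C, c != c' & hamming_dist c c' = d]) /\
  (forall c c', c \in C -> c' \in C -> c != c' -> (d <= hamming_dist c c')%N).

Definition code_dim_dist C (k d : nat) : Prop :=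
  \dim C = k /\ min_distance C d.

Definition weight_count C (w : nat) : nat :=
  #|[set c : 'rV[F]_n | (c \in C) && (hamming_weight c == w)]|.

(* A vector c is identified with rVpoly c = \sum_i c_i 'X^i, the remainder that
   represents its class modulo 'X^n - 1. *)
Definition ideal_mul (g : {poly F}) (a : 'rV[F]_n) : 'rV[F]_n :=
  poly_rV ((rVpoly a * g) %% ('X^n - 1)).

Fact ideal_mul_is_linear g : linear (ideal_mul g).
Proof.
move=> k a b.
by rewrite /ideal_mul linearP mulrDl -scalerAl modpD modpZl linearP.
Qed.

HB.instance Definition _ (g : {poly F}) :=
  GRing.isLinear.Build F 'rV[F]_n 'rV[F]_n _ (ideal_mul g)
    (ideal_mul_is_linear g).

(* The ideal of F['X] / ('X^n - 1) generated by g; see cyclic_idealP. *)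
Definition cyclic_ideal (g : {poly F}) : {vspace 'rV[F]_n} :=
  limg (linfun (ideal_mul g)).

Lemma cyclic_idealP g c : (0 < n)%N ->
  reflect (exists a : {poly F}, rVpoly c = (a * g) %% ('X^n - 1))
          (c \in cyclic_ideal g).
Proof.
move=> n_gt0; have szXn : size ('X^n - 1 : {poly F}) = n.+1.
  by rewrite size_XnsubC.
have nz : 'X^n - 1 != 0 :> {poly F} by rewrite -size_poly_eq0 szXn.
have szm (p : {poly F}) : (size (p %% ('X^n - 1))%R <= n)%N.
  by rewrite -ltnS -szXn ltn_modp.
apply: (iffP memv_imgP) => [[a _ ->]|[a Da]].
  by exists (rVpoly a); rewrite lfunE /= /ideal_mul poly_rV_K.
exists (poly_rV (a %% ('X^n - 1))); first exact: memvf.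
rewrite lfunE /= /ideal_mul poly_rV_K //; apply: (can_inj rVpolyK).
by rewrite Da poly_rV_K // [in RHS]mulrC modp_mul mulrC.
Qed.

(* C is the cyclic code <g> whose parity-check polynomial ('X^n - 1) / g
   is h. *)
Definition cyclic_code_with_check C (h : {poly F}) : Prop :=
  exists g : {poly F},
    [/\ g \is monic, g * h = 'X^n - 1 & C = cyclic_ideal g].

End LinearCodes.

Section MinimalPolynomial.

Variables (F : fieldType) (L : fieldExtType F).

(* minPoly 1 x has its coefficients in the image of F in L; this is the same
   polynomial with coefficients in F. *)
Definition base_minPoly (x : L) : {poly F} :=
  sval (sig_eqW (elimT polyOver1P (minPolyOver 1%AS x))).

Lemma map_base_minPoly x : map_poly (in_alg L) (base_minPoly x) = minPoly 1 x.
Proof. by rewrite /base_minPoly; case: sig_eqW. Qed.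

Definition generates_units (x : L) : Prop :=
  x != 0 /\ forall y : L, y != 0 -> exists k : int, y = x ^ k.

End MinimalPolynomial.

(* The index set {1} \cup {q ^ (2i-1) + 1 : 1 <= i <= m/2}, for m even. *)
Definition Gamma (q m : nat) : seq nat :=
  1%N :: [seq (q ^ (2 * i - 1) + 1)%N | i <- iota 1 m./2].

Lemma Gamma_uniq q m : (1 < q)%N -> uniq (Gamma q m).
Proof.
move=> q1; rewrite /Gamma cons_uniq; apply/andP; split.
  apply/mapP=> -[i _]; rewrite addn1 => -[] /esym /eqP.
  by rewrite expn_eq0 -leqn0 leqNgt (ltnW q1).
rewrite map_inj_in_uniq ?iota_uniq // => i j.
rewrite !mem_iota => /andP[i0 _] /andP[j0 _] /eqP.
rewrite eqn_add2r eqn_exp2l // => /eqP e.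
by apply/eqP; rewrite -(eqn_pmul2l (isT : 0 < 2)%N) -(subnK (_ : 0 < 2 * i)%N)
  ?muln_gt0 // e subnK ?muln_gt0.
Qed.

Section CodeE.

Variables (F : finFieldType) (L : fieldExtType F) (q m : nat) (pi : L).

Definition E_check : {poly F} :=
  (\prod_(u <- Gamma q m) base_minPoly (pi ^- u)) * ('X - 1).

Definition E_code : {vspace 'rV[F]_(q ^ (2 * m) - 1)} :=
  cyclic_ideal _ (('X^(q ^ (2 * m) - 1) - 1) %/ E_check).

End CodeE.

Section WeightDistribution.

Variables q m : nat.

Definition f_ (j : nat) : rat :=
  (\prod_(0 <= i < j)
     (((- q%:R) ^+ m - (- q%:R) ^+ i) / ((- q%:R) ^+ j - (- q%:R) ^+ i))) *
  \prod_(0 <= l < j)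
     ((-1) ^+ (m + 1) * q%:R ^+ m + (-1) ^+ (l + 1) * q%:R ^+ l).

Definition f_sum : rat :=
  q%:R ^+ (2 * m) - 1 +
  \sum_(1 <= j < m.+1) (q%:R ^+ (2 * m) - q%:R ^+ (2 * j)) * f_ j.

(* q ^ (2m) - q ^ (2m-1) *)
Definition w0 : int := q%:Z ^+ (2 * m) - q%:Z ^+ (2 * m - 1).

Definition weight_entries_at (j : nat) : seq (int * rat) :=
  [:: (w0 - (-1) ^+ j * q%:Z ^+ (2 * m - j - 1) * (q%:Z - 1),
       (q%:R ^+ (2 * j - 1) + (-1) ^+ j * q%:R ^+ (j - 1) * (q%:R - 1)) * f_ j);
      (w0 - 1 - (-1) ^+ j * q%:Z ^+ (2 * m - j - 1) * (q%:Z - 1),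
       (q%:R ^+ (2 * j - 1) - (-1) ^+ j * q%:R ^+ (j - 1)) * (q%:R - 1) * f_ j);
      (w0 + (-1) ^+ j * q%:Z ^+ (2 * m - j - 1),
       (q%:R ^+ (2 * j - 1) - (-1) ^+ j * q%:R ^+ (j - 1)) * (q%:R - 1) * f_ j);
      (w0 - 1 + (-1) ^+ j * q%:Z ^+ (2 * m - j - 1),
       (q%:R ^+ (2 * j) - q%:R ^+ (2 * j - 1) + (-1) ^+ j * q%:R ^+ (j - 1)) *
         (q%:R - 1) * f_ j)].

(* Pairs (weight, frequency); a weight may occur in several entries. *)
Definition weight_entries : seq (int * rat) :=
  [:: (0, 1);
      (q%:Z ^+ (2 * m) - 1, q%:R - 1);
      (w0, f_sum);
      (w0 - 1, (q%:R - 1) * f_sum)] ++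
  flatten [seq weight_entries_at j | j <- iota 1 m].

End WeightDistribution.

Definition listed_count (entries : seq (int * rat)) (w : nat) : rat :=
  \sum_(e <- entries | e.1 == w%:Z) e.2.

(* Main.v *)
From HB Require Import structures.
Require Import Defs.
From mathcomp Require Import all_boot all_order all_fingroup all_algebra all_field.
From mathcomp Require Import cyclic mxabelem.
From mathcomp Require Import zify ring.
Set Implicit Arguments.
Unset Strict Implicit.
Unset Printing Implicit Defensive.
Import Order.TTheory GRing.Theory Num.Theory.
Local Open Scope ring_scope.

(** Let K be the subfield of order q^2 of L, and identify L with K^m.  For a
    Hermitian m x m matrix A over K, a vector v and a scalar c with c^q = c,
    evaluate x A x' + Tr (x v') + c at the nonzero x, in the order of the
    powers of the generator of the group of units of L, where x' denotes the
    conjugate transpose of x.  The coordinates of x are combinations of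
    the powers y^(q^(2s)) of the corresponding y in L, so this function is a
    combination of monomials y^u such that h_1, one of the h_(q^(2i-1)+1) or
    x - 1 vanishes at the inverse of the u-th power of the generator; hence the
    word is annihilated by the parity-check polynomial.  Distinct triples give
    distinct words, and there are q^(m^2+2m+1) of them, which is the most that
    the degree of the parity-check polynomial allows.  So these words are the
    whole code, and as a by-product the parity-check polynomial divides
    x^n - 1, with no study of cyclotomic cosets.

    If A has rank r, write N_e for the number of x with x A x' = e.  Counting
    the pairs with a given difference of values gives
    (N_0 - N_1)^2 = q^(2 (2m - r)), and scaling the isotropic vectors by
    the units of K gives N_0 - N_1 = 1 mod q + 1, which fixes the sign.  Completing the
    square reduces the other words to this case, and f_j is the number of
    Hermitian matrices of rank j, by the recursion that borders a matrix with
    one more row and column. *)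

(** * Counting tools and a sign argument *)

Lemma card_root_set (K : finFieldType) (p : {poly K}) :
  p != 0 -> (#|[set x | root p x]| <= (size p).-1)%N.
Proof.
move=> p0; rewrite -ltnS prednK ?size_poly_gt0 // cardE max_poly_roots //.
  by apply/allP=> x; rewrite mem_enum inE.
exact: enum_uniq.
Qed.

(** If some y were missed, the fibres over the rest of [R] would have to cover [D] with at most c
    (|R| - 1) elements. Surjectivity of the trace and of the norm follows by such counting. *)
Lemma image_onto_of_small_fibers (T U : finType) (f : T -> U) (D : {set T})
    (R : {set U}) (c : nat) :
  (0 < c)%N -> {in D, forall x, f x \in R} ->
  {in R, forall y, (#|[set x in D | f x == y]| <= c)%N} ->
  (#|R| * c <= #|D|)%N -> {in R, forall y, exists2 x, x \in D & f x = y}.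
Proof.
move=> c0 fR fc leRD y Ry.
have [x /andP[xD /eqP fx]|no] := pickP [pred x in D | f x == y].
  by exists x.
have: (#|D| <= \sum_(z in R | z != y) c)%N.
  rewrite -sum1_card (partition_big f (mem R)) //= (bigD1 y) //= big1 ?add0n.
    apply: leq_sum => z /andP[Rz _]; rewrite sum1_card.
    by apply: leq_trans (fc z Rz); rewrite -cardsE.
  by move=> x /andP[xD fx]; have:= no x; rewrite /= xD fx.
rewrite sum_nat_const => /(leq_trans leRD).
rewrite leq_pmul2r //.
have -> : #|[pred z in R | z != y]| = #|R :\ y|.
  by apply: eq_card => z; rewrite !inE andbC.
by rewrite [#|R|](cardsD1 y) Ry ltnn.
Qed.

Lemma PoszX (n k : nat) : (n ^ k)%N%:Z = n%:Z ^+ k.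
Proof. by rewrite -natz natrX natz. Qed.

(** D is (-q)^a or its negative, and (-q)^a is 1 modulo q + 1. The negative would make q + 1 divide
    2, which q > 1 excludes. *)
Lemma sign_of_square (q a : nat) (D : int) :
  (1 < q)%N -> D ^+ 2 = (q%:Z ^+ a) ^+ 2 -> (q%:Z + 1 %| D - 1)%Z ->
  D = (-1) ^+ a * q%:Z ^+ a.
Proof.
move=> q1 sqD dvD.
have dvq : (q%:Z + 1 %| q%:Z ^+ a - (-1) ^+ a)%Z.
  by rewrite subrXX opprK dvdz_mulr.
have sg2 : (-1) ^+ a * (-1) ^+ a = 1 :> int by rewrite -expr2 sqrr_sign.
have [->//|De] : D = (-1) ^+ a * q%:Z ^+ a \/ D = - ((-1) ^+ a * q%:Z ^+ a).
  have /eqP : D ^+ 2 = ((-1) ^+ a * q%:Z ^+ a) ^+ 2 by rewrite exprMn sqrr_sign mul1r.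
  by rewrite eqf_sqr => /orP[] /eqP ->; [left | right].
have : (q%:Z + 1 %| (D - 1) + (-1) ^+ a * (q%:Z ^+ a - (-1) ^+ a))%Z.
  by rewrite rpredD ?dvdz_mull.
have -> : (D - 1) + (-1) ^+ a * (q%:Z ^+ a - (-1) ^+ a) = - 2%:Z.
  rewrite De mulrBr sg2; ring.
by rewrite rpredN dvdzE => dv; have := dvdn_leq (isT : (0 < 2)%N) dv; lia.
Qed.

(** * Values of a Hermitian form *)

Section Hermitian.

Variables (K : finFieldType) (q : nat) (conj : {rmorphism K -> K}).
Hypotheses (cardK : #|K| = (q ^ 2)%N) (conjE : forall x, conj x = x ^+ q).

Lemma q_gt1 : (1 < q)%N.
Proof.
have: (1 < #|K|)%N by exact: finNzRing_gt1.
by rewrite cardK; case: q => [|[]].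
Qed.
Let q1 := q_gt1.
Let q0 : (0 < q)%N := ltnW q1.

Lemma conjK : involutive conj.
Proof. by move=> x; rewrite !conjE -exprM mulnn -cardK expf_card. Qed.

(** The subfield of order q, kept as a plain set over which sums and counts run. *)
Definition real_set : {set K} := [set x | conj x == x].
Definition tr (x : K) := x + conj x.

Lemma real_setP x : reflect (conj x = x) (x \in real_set).
Proof. by rewrite inE; exact: eqP. Qed.

Lemma tr_real x : tr x \in real_set.
Proof. by rewrite inE /tr rmorphD conjK addrC. Qed.

Lemma trD x y : tr (x + y) = tr x + tr y.
Proof. by rewrite /tr rmorphD addrACA. Qed.

Lemma norm_real x : x * conj x \in real_set.
Proof. by rewrite inE rmorphM conjK mulrC. Qed.

Lemma real_set0 : 0 \in real_set. Proof. by rewrite inE rmorph0. Qed.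
Lemma real_set1 : 1 \in real_set. Proof. by rewrite inE rmorph1. Qed.
Lemma real_setD x y : x \in real_set -> y \in real_set -> x + y \in real_set.
Proof. by move=> /real_setP hx /real_setP hy; rewrite inE rmorphD hx hy. Qed.
Lemma real_setN x : x \in real_set -> - x \in real_set.
Proof. by move=> /real_setP hx; rewrite inE rmorphN hx. Qed.

Lemma card_trace_fiber y : (#|[set x in [set: K] | tr x == y]| <= q)%N.
Proof.
have sz : size ('X^q + ('X - y%:P) : {poly K}) = q.+1.
  by rewrite size_polyDl size_polyXn // size_XsubC.
have p0 : 'X^q + ('X - y%:P) != 0 :> {poly K} by rewrite -size_poly_gt0 sz.
rewrite -[X in (_ <= X)%N]/(q.+1.-1) -sz; apply: leq_trans (card_root_set p0).
apply/subset_leq_card/subsetP=> x; rewrite !inE /tr conjE => /eqP <-.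
by rewrite rootE !hornerE /=; apply/eqP; move: (x ^+ q) => z; ring.
Qed.

(** The roots of X^q - X give the upper bound. For the lower one, the trace sends q^2 elements into
    this set with fibres of size at most q. *)
Lemma card_real : #|real_set| = q.
Proof.
apply/eqP; rewrite eqn_leq; apply/andP; split.
  have sz : size ('X^q - 'X : {poly K}) = q.+1.
    by rewrite size_polyDl size_polyXn // size_polyN size_polyX.
  have p0 : 'X^q - 'X != 0 :> {poly K} by rewrite -size_poly_gt0 sz.
  rewrite -[X in (_ <= X)%N]/(q.+1.-1) -sz; apply: leq_trans (card_root_set p0).
  apply/subset_leq_card/subsetP=> x; rewrite !inE conjE => /eqP ex.
  by rewrite rootE !hornerE /= ex subrr.
rewrite -(leq_pmul2r q0) mulnn -cardK -cardsT -sum1_card.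
rewrite (partition_big tr (mem real_set)) /=; last by move=> x _; exact: tr_real.
rewrite -sum_nat_const leq_sum // => y _.
by apply: leq_trans (card_trace_fiber y); rewrite sum1_card -cardsE.
Qed.

Lemma tr_onto y : y \in real_set -> exists x, tr x = y.
Proof.
move=> yR; have [] := image_onto_of_small_fibers q0 (f := tr) (D := setT)
  (R := real_set) (fun x _ => tr_real x) (fun y _ => card_trace_fiber y) _ yR.
  by rewrite card_real cardsT cardK mulnn.
by move=> x _; exists x.
Qed.

(** A norm fibre lies among the at most q + 1 roots of X^(q+1) - z, and q^2 - 1 = (q - 1)(q + 1), so
    no nonzero real element can be missed. *)
Lemma norm_onto y : y \in real_set -> y != 0 ->
  exists2 x, x != 0 & x * conj x = y.
Proof.
move=> yR y0.
have [|||||x] := @image_onto_of_small_fibers _ _ (fun x => x * conj x)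
  [set~ 0] (real_set :\ 0) q.+1 _ _ _ _ y; last 1 first.
- by rewrite !inE => x0 <-; exists x.
- by [].
- move=> x; rewrite !inE => x0; rewrite mulf_neq0 ?fmorph_eq0 //=.
  by have:= norm_real x; rewrite inE.
- move=> z _.
  have sz : size ('X^(q.+1) - z%:P : {poly K}) = q.+2 by rewrite size_XnsubC.
  have p0 : 'X^(q.+1) - z%:P != 0 :> {poly K} by rewrite -size_poly_gt0 sz.
  rewrite -[X in (_ <= X)%N]/(q.+2.-1) -sz.
  apply: leq_trans (card_root_set p0).
  apply/subset_leq_card/subsetP=> x; rewrite !inE conjE => /andP[_ /eqP <-].
  by rewrite rootE !hornerE /= exprS subrr.
- have := cardsD1 0 real_set; rewrite real_set0 card_real cardsC1 cardK.
  by move: #|_ :\ _| => r er; rewrite er -subn1 -mulnn; nia.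
by rewrite !inE y0; rewrite inE in yR.
Qed.

Definition adjmx m n (A : 'M[K]_(m, n)) : 'M[K]_(n, m) := (map_mx conj A)^T.
Definition hermmx m (A : 'M[K]_m) : bool := adjmx A == A.

Lemma adjK m n (A : 'M[K]_(m, n)) : adjmx (adjmx A) = A.
Proof. by apply/matrixP=> i j; rewrite !mxE conjK. Qed.

Lemma adjM m n p (A : 'M[K]_(m, n)) (B : 'M[K]_(n, p)) :
  adjmx (A *m B) = adjmx B *m adjmx A.
Proof. by rewrite /adjmx map_mxM trmx_mul. Qed.

Lemma adjD m n (A B : 'M[K]_(m, n)) : adjmx (A + B) = adjmx A + adjmx B.
Proof. by rewrite /adjmx map_mxD linearD. Qed.

Lemma adjN m n (A : 'M[K]_(m, n)) : adjmx (- A) = - adjmx A.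
Proof. by rewrite /adjmx map_mxN linearN. Qed.

Lemma adjZ m n a (A : 'M[K]_(m, n)) : adjmx (a *: A) = conj a *: adjmx A.
Proof. by rewrite /adjmx map_mxZ linearZ. Qed.

Lemma adj0 m n : adjmx (0 : 'M[K]_(m, n)) = 0.
Proof. by rewrite /adjmx map_mx0 linear0. Qed.

Lemma rank_adj m n (A : 'M[K]_(m, n)) : \rank (adjmx A) = \rank A.
Proof. by rewrite /adjmx mxrank_tr mxrank_map. Qed.

Definition scal (M : 'M[K]_1) := M 0 0.

Lemma scal_adj (M : 'M[K]_1) : scal (adjmx M) = conj (scal M).
Proof. by rewrite /scal !mxE. Qed.

Lemma scalD M N : scal (M + N) = scal M + scal N.
Proof. by rewrite /scal mxE. Qed.

Lemma scalN M : scal (- M) = - scal M.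
Proof. by rewrite /scal mxE. Qed.

Lemma scalZ a M : scal (a *: M) = a * scal M.
Proof. by rewrite /scal mxE. Qed.

Section Form.

Variables (m : nat) (A : 'M[K]_m).
Hypothesis hA : hermmx A.
Let hAE : adjmx A = A := eqP hA.

Definition herm_form (x : 'rV[K]_m) : K := scal (x *m A *m adjmx x).

Lemma qform_real x : herm_form x \in real_set.
Proof. by rewrite inE /herm_form -scal_adj !adjM adjK hAE mulmxA. Qed.

Lemma qform0 : herm_form 0 = 0.
Proof. by rewrite /herm_form !mul0mx /scal mxE. Qed.

Lemma qformD x y :
  herm_form (x + y) = herm_form x + herm_form y + tr (scal (x *m A *m adjmx y)).
Proof.
rewrite /herm_form /tr -scal_adj !adjM adjK hAE adjD !mulmxDl !mulmxDr !mulmxA.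
rewrite !scalD.
ring.
Qed.

Lemma qformZ k x : herm_form (k *: x) = k * conj k * herm_form x.
Proof.
by rewrite /herm_form adjZ -!scalemxAl -scalemxAr !scalZ mulrA.
Qed.

End Form.

(** Translations carry any level set onto any other, so the q level sets share the q^(2m) vectors
    equally. *)
Lemma card_level_translation m (f : 'rV[K]_m -> K) :
  (forall x, f x \in real_set) ->
  {in real_set, forall e, exists s, forall x, f (x + s) = f x + e} ->
  {in real_set, forall e, (q * #|[set x | f x == e]| = q ^ (2 * m))%N}.
Proof.
move=> fR fs e eR.
have form_level y : y \in real_set -> #|[set x | f x == y]| = #|[set x | f x == e]|.
  move=> yR; have [s hs] := fs (y - e) (real_setD yR (real_setN eR)).
  rewrite -[RHS](card_imset _ (addIr s)); apply: eq_card => x.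
  apply/idP/imsetP=> [|[z]]; rewrite inE => /eqP.
    move=> fx; exists (x - s); last by rewrite subrK.
    by rewrite inE -(inj_eq (addIr (y - e))) -hs subrK fx addrCA subrr addr0.
  by move=> fz ->; rewrite inE hs fz addrCA subrr addr0.
have -> : (q ^ (2 * m) = \sum_(x : 'rV[K]_m) 1)%N.
  by rewrite sum1_card card_mx mul1n cardK -expnM.
rewrite (partition_big f (mem real_set)) /=; last by move=> x _; exact: fR.
rewrite -card_real -sum_nat_const; apply: eq_bigr => y yR.
by rewrite -(form_level y yR) -sum1_card; apply: eq_bigl => x; rewrite inE.
Qed.

Lemma scal_mul_onto m (b : 'cV[K]_m) : b != 0 ->
  forall k, exists s : 'rV[K]_m, scal (s *m b) = k.
Proof.
move=> /cV0Pn[i bi] k; exists ((k / b i 0) *: delta_mx 0 i).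
by rewrite -scalemxAl -rowE /scal !mxE divfK.
Qed.

Section Levels.

Variables (m : nat) (A : 'M[K]_m).
Hypothesis hA : hermmx A.
Let hAE : adjmx A = A := eqP hA.

Definition kernel : {set 'rV[K]_m} := [set z | z *m A == 0].

Lemma card_kernel : #|kernel| = (q ^ (2 * (m - \rank A)))%N.
Proof.
rewrite -mxrank_ker expnM -cardK -card_rowg; apply: eq_card => z.
by rewrite !inE; apply/eqP/sub_kermxP.
Qed.

Definition form_level e : nat := #|[set x | herm_form A x == e]|.
Arguments form_level e%_R.

(** Scaling x by k multiplies the form by the norm of k, and every nonzero real e is a norm. *)
Lemma level_ne0 e : e \in real_set -> e != 0 -> form_level e = form_level 1.
Proof.
move=> eR e0; have [k k0 ke] := norm_onto eR e0.
rewrite /form_level -[RHS](card_imset _ (can_inj (scalerK k0))).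
apply: eq_card => x; apply/idP/imsetP => [|[z]]; rewrite !inE => /eqP hx.
  exists (k^-1 *: x); last by rewrite scalerKV.
  by rewrite inE qformZ hx fmorphV -invfM ke mulVf.
by move=> ->; rewrite qformZ hx ke mulr1.
Qed.

Lemma sum_level : (form_level 0 + (q - 1) * form_level 1 = q ^ (2 * m))%N.
Proof.
have -> : (q ^ (2 * m) = \sum_(x : 'rV[K]_m) 1)%N.
  by rewrite sum1_card card_mx mul1n cardK -expnM.
rewrite (partition_big (herm_form A) (mem real_set)) /=; last first.
  by move=> x _; exact: qform_real.
rewrite (bigD1 0) ?real_set0 //=; congr (_ + _)%N.
  by rewrite /form_level -sum1_card; apply: eq_bigl => x; rewrite inE.
rewrite (eq_bigr (fun _ => form_level 1)); last first.
  move=> e /andP[eR e0]; rewrite -(level_ne0 eR e0) /form_level -sum1_card.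
  by apply: eq_bigl => x; rewrite inE.
rewrite sum_nat_const; congr (_ * _)%N.
have := cardsD1 0 real_set; rewrite real_set0 card_real => qE.
by rewrite {1}qE addKn; apply: eq_card => x; rewrite in_setD1 andbC.
Qed.

(** Counts the pairs of vectors with difference z whose values differ by e; summing over z counts
    all pairs in two ways. *)
Definition shift_level e z : nat :=
  #|[set y | herm_form A (y + z) == herm_form A y + e]|.
Arguments shift_level (e z)%_R.

Lemma qform_shift_kernel y z : z \in kernel -> herm_form A (y + z) = herm_form A y.
Proof.
rewrite inE => /eqP zA; have Az : A *m adjmx z = 0.
  by rewrite -hAE -adjM zA adj0.
rewrite qformD // -mulmxA Az mulmx0 {2}/herm_form zA mul0mx /scal /tr !mxE.
by rewrite rmorph0 !addr0.
Qed.

Lemma tr_scal_shift (b : 'cV[K]_m) : b != 0 -> {in real_set, forall e,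
  exists s : 'rV[K]_m, tr (scal (s *m b)) = e}.
Proof.
move=> b0 e eR; have [k <-] := tr_onto eR.
by have [s hs] := scal_mul_onto b0 k; exists s; rewrite hs.
Qed.

(** A shift by z in the kernel never changes the value. For any other z the change is a constant
    plus the trace of a nonzero linear form in y, so it takes all real values equally often. *)
Lemma shift_level_diff z :
  shift_level 0 z = (shift_level 1 z + (z \in kernel) * q ^ (2 * m))%N.
Proof.
have [zk | zk] := boolP (z \in kernel).
  have -> : shift_level 1 z = 0%N.
    apply: eq_card0 => y; rewrite inE qform_shift_kernel // -{1}[herm_form A y]addr0.
    by rewrite (inj_eq (addrI _)) eq_sym oner_eq0.
  rewrite add0n mul1n expnM -cardK -[m in RHS]mul1n -card_mx -cardsT.
  by apply: eq_card => y; rewrite !inE qform_shift_kernel // addr0 eqxx.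
rewrite mul0n addn0; apply/eqP; rewrite -(eqn_pmul2l q0).
have Az : A *m adjmx z != 0.
  apply: contra zk => /eqP Az; rewrite inE; apply/eqP.
  by rewrite -[z *m A]adjK adjM hAE Az adj0.
pose f y := herm_form A z + tr (scal (y *m (A *m adjmx z))).
have fE e : shift_level e z = #|[set y | f y == e]|.
  apply: eq_card => y; rewrite !inE qformD // -addrA (inj_eq (addrI _)).
  by rewrite /f mulmxA.
have fR y : f y \in real_set by rewrite real_setD ?qform_real ?tr_real.
rewrite !fE !card_level_translation ?real_set0 ?real_set1 // => e eR.
all: have [s hs] := tr_scal_shift Az eR; exists s => y.
all: by rewrite /f mulmxDl scalD trD hs addrA.
Qed.

Lemma sum_shift_level e :
  (\sum_z shift_level e z = \sum_y form_level (herm_form A y + e)%R)%N.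
Proof.
under eq_bigr => z _ do rewrite /shift_level -sum1_card.
rewrite (exchange_big_dep xpredT) //=; apply: eq_bigr => y _.
rewrite /form_level -sum1_card [RHS](reindex_inj (addrI y)) /=.
by apply: eq_bigl => z; rewrite !inE.
Qed.

(** With D = N_0 - N_1, the number of pairs of equal value minus the number of pairs whose values
    differ by 1 is D^2 by levels, and q^(2m) times the size of the kernel by differences z. *)
Lemma level_diff_sqr :
  ((form_level 0)%:Z - (form_level 1)%:Z) ^+ 2 = (q%:Z ^+ (2 * m - \rank A)) ^+ 2.
Proof.
set D := _ - _.
have levelE e : e \in real_set -> (form_level e)%:Z = (form_level 1)%:Z + D * (e == 0)%:R.
  move=> eR; have [->|e0] := eqVneq e 0; first by rewrite mulr1 /D addrC subrK.
  by rewrite mulr0 addr0 (level_ne0 eR e0).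
have sumE e : e \in real_set -> (\sum_y form_level (herm_form A y + e)%R)%N%:Z =
    (q ^ (2 * m))%N%:Z * (form_level 1)%:Z + D * (form_level (- e))%:Z.
  move=> eR; rewrite -[Posz _]natz natr_sum.
  under eq_bigr => y _ do
    rewrite natz levelE ?real_setD ?qform_real // addr_eq0.
  rewrite big_split /= sumr_const -mulr_sumr; congr (_ + _ * _).
    by rewrite card_mx mul1n cardK -expnM -mulr_natl natz.
  rewrite /form_level -sum1_card -natz natr_sum [RHS]big_mkcond /=.
  by apply: eq_bigr => y _; rewrite inE; case: eqP.
have := sum_shift_level 0; under eq_bigr do rewrite shift_level_diff.
rewrite big_split /= sum_shift_level -big_distrl /= => /(congr1 Posz).
rewrite PoszD !sumE ?real_set0 ?real_set1 // oppr0.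
rewrite (level_ne0 (real_setN real_set1)); last first.
  by rewrite oppr_eq0 oner_eq0.
have -> : (\sum_z (z \in kernel) = #|kernel|)%N.
  by rewrite -sum1_card [RHS]big_mkcond; apply: eq_bigr => z _; case: (z \in _).
rewrite card_kernel => e1.
have -> : D ^+ 2 = (q ^ (2 * (m - \rank A)) * q ^ (2 * m))%N%:Z.
  rewrite expr2 {2}/D mulrBr -addrA in e1 *; move/addrI: e1 => <-.
  by rewrite addrAC subrr add0r.
rewrite -expnD -exprM PoszX; congr (_ ^+ _).
by have := rank_leq_row A; lia.
Qed.

(* Scaling by units: a nonzero isotropic vector is determined by its first nonzero
   entry and the multiple of it in which that entry is 1. *)
Lemma level0_dvd : (q ^ 2 - 1 %| form_level 0 - 1)%N.
Proof.
pose lead (x : 'rV[K]_m) := if [pick k | x 0 k != 0] is Some k then x 0 k else 0.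
have leadZ c x : c != 0 -> lead (c *: x) = c * lead x.
  move=> c0; rewrite /lead (eq_pick (Q := fun k => x 0 k != 0)); last first.
    by move=> k; rewrite mxE mulf_eq0 negb_or c0.
  by case: pickP => [k _|_]; rewrite ?mxE ?mulr0.
have lead0 x : (lead x == 0) = (x == 0).
  rewrite /lead; case: pickP => [k xk|no].
    apply/idP/idP=> [x0|/eqP x0]; first by rewrite x0 in xk.
    by rewrite x0 mxE eqxx in xk.
  by rewrite eqxx; apply/esym/eqP/rowP=> k; have /negbFE/eqP-> := no k; rewrite mxE.
have -> : (form_level 0 - 1 = #|[set x | (herm_form A x == 0)%R && (x != 0)%R]|)%N.
  rewrite /form_level (cardsD1 0) inE qform0 eqxx addKn.
  by apply: eq_card => x; rewrite !inE andbC.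
rewrite -sum1_card (partition_big lead (mem [set~ 0])) /=; last first.
  by move=> x; rewrite !inE lead0 => /andP[].
rewrite (eq_bigr (fun _ => #|[set x | (herm_form A x == 0) && (lead x == 1)]|)).
  by rewrite sum_nat_const cardsC1 cardK subn1 dvdn_mulr.
move=> c; rewrite !inE => c0.
rewrite -(card_imset _ (can_inj (scalerK c0))) -sum1_card; apply: eq_bigl => x.
rewrite inE; apply/andP/imsetP => [[/andP[q0x x0] /eqP lx]|[y]].
  exists (c^-1 *: x); last by rewrite scalerKV.
  by rewrite inE qformZ (eqP q0x) mulr0 eqxx leadZ ?invr_eq0 // lx mulVf /=.
rewrite inE => /andP[/eqP qy /eqP ly] ->.
by rewrite qformZ qy mulr0 leadZ // ly mulr1 -lead0 leadZ // ly mulr1 c0 !eqxx.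
Qed.

Lemma level_diff :
  (form_level 0)%:Z - (form_level 1)%:Z = (-1) ^+ \rank A * q%:Z ^+ (2 * m - \rank A).
Proof.
have rm := rank_leq_row A.
rewrite (sign_of_square q1 level_diff_sqr) //.
  (* The exponent 2m - r has the parity of r. *)
  rewrite -signr_odd -[in RHS]signr_odd oddB ?oddM //.
  by apply: leq_trans rm _; rewrite mul2n -addnn leq_addr.
have l0 : (0 < form_level 0)%N.
  by apply/card_gt0P; exists 0; rewrite inE qform0.
have /dvdnP[k kE] := level0_dvd.
have : (q ^ 2 - 1 %| q ^ (2 * m) - 1)%N.
  by rewrite expnM !subn1 dvdn_pred_predX.
case/dvdnP=> l lE.
(* Since q^2 - 1 divides both N_0 - 1 and q^(2m) - 1, it divides (q - 1) N_1, so q + 1 divides N_1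
   and D is 1 modulo q + 1. *)
suff [t ->] : exists t, form_level 1 = ((q + 1) * t)%N.
  apply/dvdzP; exists (k%:Z * (q%:Z - 1) - t%:Z); rewrite -mulnn in kE; nia.
exists (l - k)%N; have := sum_level; have := expn_gt0 q (2 * m).
by rewrite q0 /= -mulnn in lE kE *; nia.
Qed.

(** Solves the two linear equations for N_0 and N_1 given by their weighted sum and their
    difference; the factor q avoids a division. *)
Lemma levelE e : e \in real_set -> q%:Z * (form_level e)%:Z =
  q%:Z ^+ (2 * m) + (-1) ^+ \rank A * q%:Z ^+ (2 * m - \rank A) *
     (q%:Z * (e == 0)%:R - 1).
Proof.
move=> eR; have := sum_level; rewrite -level_diff => /(congr1 Posz).
rewrite PoszD PoszM -subzn // PoszX => <-.
have [->|e0] := eqVneq e 0; first by rewrite /= mulr1; ring.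
by rewrite /= (level_ne0 eR e0); ring.
Qed.

End Levels.

End Hermitian.

Lemma rank_col_mx_row (F : fieldType) m n (w : 'rV[F]_n) (B : 'M[F]_(m, n)) :
  \rank (col_mx w B) = (~~ (w <= B)%MS + \rank B)%N.
Proof.
rewrite -addsmxE; have [wB|wB] := boolP (w <= B)%MS.
  by rewrite add0n; apply/eqmx_rank; rewrite addsmxSr addsmx_sub wB submx_refl.
have : (B < w + B)%MS.
  by rewrite ltmxE addsmxSr addsmx_sub submx_refl andbT.
rewrite ltmxErank addsmxSr /= => ltr; apply/eqP; rewrite eqn_leq ltr andbT.
by apply: leq_trans (mxrank_adds_leqif w B) _; rewrite leq_add2r rank_leq_row.
Qed.

(** * Hermitian matrices of given rank *)

Section GaussianRatio.

Variable Q : rat.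
Hypothesis Q_pow : forall j, Q ^+ j.+1 != 1.
Hypothesis Q_neq0 : Q != 0.

(* At Q = - q and z = q ^ (2m), this is f_j. *)
Definition herm_rank_poly (z : rat) (j : nat) : rat :=
  \prod_(i < j) ((Q ^+ (2 * i) - z) / (Q ^+ j - Q ^+ i)).

Let num z j := \prod_(i < j) (Q ^+ (2 * i) - z).
Let den j := \prod_(i < j) (Q ^+ j - Q ^+ i).

Lemma herm_rank_polyE z j : herm_rank_poly z j = num z j / den j.
Proof. by rewrite /herm_rank_poly big_split /= prodfV. Qed.

Lemma herm_rank_num_rec z j : num z j.+1 = num z j * (Q ^+ (2 * j) - z).
Proof. by rewrite /num big_ord_recr. Qed.

Lemma herm_rank_num_scale z j :
  num (Q ^+ 2 * z) j.+1 = (1 - Q ^+ 2 * z) * Q ^+ (2 * j) * num z j.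
Proof.
rewrite /num big_ord_recl /= muln0 expr0 -mulrA; congr (_ * _).
transitivity (\prod_(i < j) (Q ^+ 2 * (Q ^+ (2 * i) - z))).
  by apply: eq_bigr => i _; rewrite mulrBr -exprD /bump /= mulnDr.
by rewrite big_split /= prodr_const card_ord exprM.
Qed.

Lemma herm_rank_den_rec j : den j.+1 = (Q ^+ j.+1 - 1) * Q ^+ j * den j.
Proof.
rewrite /den big_ord_recl /= expr0 -mulrA; congr (_ * _).
transitivity (\prod_(i < j) (Q * (Q ^+ j - Q ^+ i))).
  by apply: eq_bigr => i _; rewrite mulrBr -!exprS.
by rewrite big_split /= prodr_const card_ord.
Qed.

Lemma herm_rank_den_neq0 j : den j != 0.
Proof.
elim: j => [|j IH]; first by rewrite /den big_ord0 oner_neq0.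
by rewrite herm_rank_den_rec !mulf_neq0 ?expf_neq0 ?subr_eq0.
Qed.

Lemma herm_rank_poly0 z : herm_rank_poly z 0 = 1.
Proof. by rewrite /herm_rank_poly big_ord0. Qed.

(** Rank 1 stands apart because the general recursion would refer to the index j - 2. *)
Lemma herm_rank_poly_rec1 z :
  herm_rank_poly (Q ^+ 2 * z) 1 = Q ^+ 2 * herm_rank_poly z 1 + (- Q - 1).
Proof.
rewrite /herm_rank_poly !big_ord1 muln0 !expr0 expr1.
have := Q_pow 0; rewrite expr1 -subr_eq0 => Q1.
by field.
Qed.

(** At Q = -q and z = q^(2m) this is the bordering recursion from size m to m + 1: the three terms
    come from borders that raise the rank by 0, 1 and 2. *)
Lemma herm_rank_poly_rec2 z j :
  herm_rank_poly (Q ^+ 2 * z) j.+2 =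
    Q ^+ (2 * j.+2) * herm_rank_poly z j.+2 +
    (- Q - 1) * Q ^+ (2 * j.+1) * herm_rank_poly z j.+1 +
    (z - Q ^+ (2 * j)) * (- Q) * herm_rank_poly z j.
Proof.
have q1 := Q_pow j; have q2 := Q_pow j.+1; have dj := herm_rank_den_neq0 j.
rewrite !herm_rank_polyE herm_rank_num_scale !herm_rank_den_rec.
rewrite (herm_rank_num_rec z j.+1) (herm_rank_num_rec z j).
rewrite -subr_eq0 in q1; rewrite -subr_eq0 in q2.
have -> : Q ^+ (2 * j.+2) = Q ^+ 4 * (Q ^+ j) ^+ 2.
  by rewrite -exprM -exprD; congr (_ ^+ _); lia.
have -> : Q ^+ (2 * j.+1) = Q ^+ 2 * (Q ^+ j) ^+ 2.
  by rewrite -exprM -exprD; congr (_ ^+ _); lia.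
have -> : Q ^+ (2 * j) = (Q ^+ j) ^+ 2 by rewrite mulnC exprM.
have x0 : Q ^+ j != 0 by rewrite expf_neq0.
rewrite !exprS in q1 q2 *.
(* Once Q^j and the common products are variables, a rational identity remains. *)
move: (Q ^+ j) x0 q1 q2 (num z j) (den j) dj => x x0 q1 q2 N D D0.
by field; rewrite Q_neq0 x0 D0 q1 q2.
Qed.

Lemma herm_rank_poly_big z r j : (r < j)%N -> z = Q ^+ (2 * r) -> herm_rank_poly z j = 0.
Proof.
move=> rj ->; rewrite /herm_rank_poly (bigD1 (Ordinal rj)) //=.
by rewrite subrr mul0r mul0r.
Qed.

End GaussianRatio.

Section HermitianRank.

Variables (K : finFieldType) (q : nat) (conj : {rmorphism K -> K}).
Hypotheses (cardK : #|K| = (q ^ 2)%N) (conjE : forall x, conj x = x ^+ q).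
Let q1 : (1 < q)%N := q_gt1 cardK.
Local Notation adj := (adjmx conj).
Local Notation herm := (hermmx conj).
Local Notation realK := (real_set conj).

Definition bord m (d : K) (v : 'rV[K]_m) (A : 'M[K]_m) : 'M[K]_(1 + m) :=
  block_mx d%:M v (adj v) A.

Lemma adj_block m1 m2 n1 n2 (A : 'M[K]_(m1, n1)) (B : 'M_(m1, n2))
    (C : 'M_(m2, n1)) (D : 'M_(m2, n2)) :
  adj (block_mx A B C D) = block_mx (adj A) (adj C) (adj B) (adj D).
Proof. by rewrite /adjmx map_block_mx tr_block_mx. Qed.

Lemma adj_scalar m a : adj (a%:M : 'M_m) = (conj a)%:M.
Proof. by rewrite /adjmx map_scalar_mx tr_scalar_mx. Qed.

Lemma herm_bord m d (v : 'rV_m) A : herm (bord d v A) = (d \in realK) && herm A.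
Proof.
rewrite /hermmx /bord adj_block (adjK cardK conjE) adj_scalar inE.
apply/eqP/andP => [/eq_block_mx[e1 _ _ ->]|[/eqP-> /eqP->] //].
by have /matrixP/(_ 0 0) := e1; rewrite !mxE eqxx !mulr1n => ->.
Qed.

Lemma bord_sub m (M : 'M[K]_(1 + m)) : herm M ->
  bord (ulsubmx M 0 0) (ursubmx M) (drsubmx M) = M.
Proof.
move=> /eqP hM; rewrite -[RHS]submxK /bord -mx11_scalar; congr (block_mx _ _ _ _).
by apply/matrixP=> i j; rewrite -[in RHS]hM !mxE.
Qed.

(** If v = u A, elimination leaves d - u A u' in the corner, so the rank grows by one unless this
    vanishes. If v is outside the row space, the new column and the new row each add one. *)
Lemma rank_bord m d (v : 'rV_m) (A : 'M_m) : herm A ->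
  (forall u, v = u *m A ->
     \rank (bord d v A) = ((d != scal (u *m A *m adj u)) + \rank A)%N) /\
  (~~ (v <= A)%MS -> \rank (bord d v A) = (\rank A).+2).
Proof.
move=> /eqP hA; rewrite /bord /block_mx rank_col_mx_row.
have -> : \rank (row_mx (adj v) A) = (~~ (v <= A)%MS + \rank A)%N.
  rewrite -rank_col_mx_row -(rank_adj conj) /adjmx map_row_mx tr_row_mx.
  by rewrite -!/(adjmx _ _) (adjK cardK conjE) hA.
split=> [u vE | nvA].
  have vA : (v <= A)%MS by rewrite vE submxMl.
  have avE : adj v = A *m adj u by rewrite vE adjM hA.
  rewrite vA add0n; congr ((~~ _) + _)%N.
  apply/submxP/eqP=> [[y]|->].
    rewrite mul_mx_row avE => /eq_row_mx[yd yA].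
    by rewrite -vE yA -mulmxA /scal -yd mxE eqxx mulr1n.
  exists u; rewrite mul_mx_row -vE avE mulmxA -vE; congr row_mx.
  by rewrite [RHS]mx11_scalar.
rewrite nvA; suff -> : (row_mx d%:M v <= row_mx (adj v) A)%MS = false by [].
apply/negbTE; apply: contra nvA => /submxP[y].
by rewrite mul_mx_row => /eq_row_mx[_ ->]; exact: submxMl.
Qed.

(** Of the q^(2m) borders v, q^(2r) lie in the row space; for these one real corner keeps the rank
    and q - 1 raise it by 1. For the others all q corners raise it by 2. A general [G] serves both
    the count by rank and the total count. *)
Lemma sum_herm_bord m (G : nat -> rat) :
  \sum_(M : 'M[K]_(1 + m) | herm M) G (\rank M) =
  \sum_(A : 'M[K]_m | herm A)
    ((q%:R ^+ (2 * m) - q%:R ^+ (2 * \rank A)) * q%:R * G (\rank A).+2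
    + q%:R ^+ (2 * \rank A) * (G (\rank A) + (q%:R - 1) * G (\rank A).+1)).
Proof.
pose h (p : 'M[K]_m * ('rV[K]_m * K)) := bord p.2.2 p.2.1 p.1.
pose h' (M : 'M[K]_(1 + m)) := (drsubmx M, (ursubmx M, ulsubmx M 0 0)).
rewrite (reindex_onto h h') /=; last by move=> M hM; exact: bord_sub.
transitivity (\sum_(p | herm p.1 && (p.2.2 \in realK)) G (\rank (h p))).
  apply: eq_bigl => -[A [v d]]; rewrite /h /h' /= herm_bord andbC.
  rewrite block_mxKdr block_mxKur block_mxKul mxE mulr1n eqxx andTb.
  by rewrite andbC.
rewrite -(pair_big_dep (fun A => herm A) (fun A p => p.2 \in realK)
            (fun A p => G (\rank (bord p.2 p.1 A)))) /=.
apply: eq_bigr => A hA.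
rewrite -(pair_big_dep xpredT (fun v d => d \in realK)
            (fun v d => G (\rank (bord d v A)))) /=.
set r := \rank A.
rewrite (bigID (fun v : 'rV_m => (v <= A)%MS)) /= addrC.
have cV : #|[set v : 'rV[K]_m | (v <= A)%MS]| = (q ^ (2 * r))%N.
  by rewrite -/(rowg A) card_rowg cardK -expnM.
congr (_ + _).
  rewrite (eq_bigr (fun _ => q%:R * G r.+2)); last first.
    move=> v nv; rewrite (eq_bigr (fun _ => G r.+2)).
      by rewrite sumr_const (card_real cardK conjE) mulr_natl.
    by move=> d _; have [_ ->] := rank_bord d v hA.
  rewrite sumr_const -[RHS]mulrA -[LHS]mulr_natl; congr (_ * _).
  have := cardsC [set v : 'rV[K]_m | (v <= A)%MS]; rewrite cV card_mx mul1n cardK -expnM.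
  move/(congr1 (fun k => k%:R : rat)); rewrite natrD !natrX => <-; rewrite addrAC subrr add0r.
  by congr _%:R; apply: eq_card => v; rewrite !inE.
rewrite (eq_bigr (fun _ => G r + (q%:R - 1) * G r.+1)); last first.
  move=> v /submxP[u vE].
  pose d0 := scal (u *m A *m adj u).
  have d0R : d0 \in realK by exact: (qform_real cardK conjE hA u).
  rewrite (bigD1 d0) //=; congr (_ + _).
    by have [/(_ u vE) ->] := rank_bord d0 v hA; rewrite eqxx.
  rewrite (eq_bigr (fun _ => G r.+1)); last first.
    by move=> d /andP[_ dd]; have [/(_ u vE) ->] := rank_bord d v hA; rewrite dd.
  rewrite sumr_const -[LHS]mulr_natl; congr (_ * _).
  have := cardsD1 d0 realK; rewrite d0R (card_real cardK conjE) => qE.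
  rewrite [in RHS]qE natrD addrAC subrr add0r; congr _%:R.
  by apply: eq_card => d; rewrite in_setD1 andbC.
rewrite sumr_const -[LHS]mulr_natl; congr (_ * _).
by rewrite -natrX -cV; congr _%:R; apply: eq_card => v; rewrite !inE.
Qed.

Definition herm_count m j : nat := #|[set A : 'M[K]_m | herm A && (\rank A == j)]|.

Lemma herm_countE m j :
  (herm_count m j)%:R = \sum_(A : 'M[K]_m | herm A) (\rank A == j)%:R :> rat.
Proof.
rewrite /herm_count -sum1_card natr_sum [LHS]big_mkcond [RHS]big_mkcond /=.
by apply: eq_bigr => A _; rewrite inE; case: (herm A) => //=; case: (_ == j).
Qed.

Lemma sum_herm_rank m (G : nat -> rat) :
  \sum_(A : 'M[K]_m | herm A) G (\rank A) = \sum_(j < m.+1) (herm_count m j)%:R * G j.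
Proof.
rewrite (partition_big (fun A => inord (\rank A) : 'I_m.+1) xpredT) //=.
apply: eq_bigr => j _; rewrite herm_countE big_distrl big_mkcondr /=.
have rj (A : 'M[K]_m) : (inord (\rank A) == j) = (\rank A == j).
  by rewrite -val_eqE /= inordK // ltnS rank_leq_row.
apply: eq_bigr => A _; rewrite rj.
by case: eqP => [->|_]; rewrite ?mul1r ?mul0r.
Qed.

(** Induction on m: both sides obey the bordering recursion, in which q^(2m) is multiplied by
    Q^2. *)
Lemma herm_count_rank_poly m j :
  (herm_count m j)%:R = herm_rank_poly (- q%:R) (q%:R ^+ (2 * m)) j.
Proof.
have q0 : (0 < q)%N by exact: ltnW.
pose Q : rat := - q%:R.
have Q0 : Q != 0 by rewrite oppr_eq0 pnatr_eq0 -lt0n.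
(* Q is not a root of unity, as its absolute value q exceeds 1. *)
have Qp i : Q ^+ i.+1 != 1.
  rewrite -(inj_eq (@oppr_inj _)); apply/eqP => /(congr1 (fun x : rat => `|x|)).
  rewrite !normrN normrX normrN normr1 normr_nat => /eqP.
  by rewrite -natrX -[1]/(1%:R) eqr_nat -(expn0 q) eqn_exp2l.
have Q2 k : Q ^+ (2 * k) = q%:R ^+ (2 * k) by rewrite !exprM sqrrN.
elim: m j => [|m IH] j.
  rewrite muln0 expr0; case: j => [|j].
    rewrite herm_rank_poly0 /herm_count (eq_card (B := [set: 'M[K]_0])).
      by rewrite cardsT card_mx mul0n expn0.
    move=> A; rewrite !inE /hermmx (flatmx0 A) (flatmx0 (adj _)) eqxx.
    by have := rank_leq_row (0 : 'M[K]_0); rewrite leqn0.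
  rewrite (herm_rank_poly_big (r := 0)) ?muln0 //.
  rewrite /herm_count (eq_card (B := set0)) ?cards0 // => A; rewrite !inE.
  have := rank_leq_row A; case: eqP; rewrite ?andbF // => ->.
  by rewrite ltn0.
rewrite herm_countE [LHS](@sum_herm_bord m (fun r => (r == j)%:R)).
have -> : q%:R ^+ (2 * m.+1) = Q ^+ 2 * q%:R ^+ (2 * m) :> rat.
  by rewrite mulnS exprD sqrrN.
(* Each term of the recursion only sees the matrices of one rank i, which the induction hypothesis
   counts. *)
have part (c : nat -> rat) i : \sum_(A : 'M[K]_m | herm A) c (\rank A) * (\rank A == i)%:R
    = c i * herm_rank_poly Q (q%:R ^+ (2 * m)) i.
  rewrite -IH herm_countE mulr_sumr; apply: eq_bigr => A _.
  by case: eqP => [->|_] //; rewrite !mulr0.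
case: j => [|[|j]].
- under eq_bigr => A _ do rewrite !mulr0 add0r addr0.
  by rewrite (part (fun r => q%:R ^+ (2 * r))) !herm_rank_poly0 muln0 mulr1.
- rewrite herm_rank_poly_rec1 //.
  under eq_bigr => A _ do rewrite mulr0 add0r mulrDr eqSS mulrA.
  rewrite big_split /= (part (fun r => q%:R ^+ (2 * r))).
  rewrite (part (fun r => q%:R ^+ (2 * r) * (q%:R - 1))) herm_rank_poly0.
  by rewrite muln0 expr0 -Q2 !mul1r mulr1 opprK.
rewrite herm_rank_poly_rec2 //.
under eq_bigr => A _ do rewrite mulrDr !eqSS mulrA.
rewrite !big_split /= (part (fun r => q%:R ^+ (2 * r))).
rewrite (part (fun r => q%:R ^+ (2 * r) * (q%:R - 1))).
rewrite (part (fun r => (q%:R ^+ (2 * m) - q%:R ^+ (2 * r)) * q%:R)).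
by rewrite !Q2 opprK addrC; congr (_ + _ + _); rewrite [_ * (_ - 1)]mulrC.
Qed.

(** For the constant function 1 the bordering recursion collapses to the factor q^(2m+1), regardless
    of the rank. *)
Lemma card_herm m : #|[set A : 'M[K]_m | herm A]| = (q ^ (m ^ 2))%N.
Proof.
apply/eqP; rewrite -(eqr_nat rat) natrX; apply/eqP.
have -> : #|[set A : 'M[K]_m | herm A]|%:R = \sum_(A : 'M[K]_m | herm A) 1 :> rat.
  by rewrite sumr_const; congr (_ *+ _); apply: eq_card => A; rewrite inE.
elim: m => [|m IH].
  rewrite (big_pred1 0) ?expr0 // => A.
  by rewrite (flatmx0 A) /= eqxx; apply/eqP; exact: flatmx0.
rewrite [LHS](@sum_herm_bord m (fun=> 1)).
rewrite (eq_bigr (fun _ => q%:R ^+ (2 * m) * q%:R * 1)); last by move=> A _; ring.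
by rewrite -mulr_sumr IH -exprSr -exprD; congr (_ ^+ _); rewrite -!mulnn; lia.
Qed.

End HermitianRank.

(** * Weights of the evaluation words *)

Section Words.

Variables (K : finFieldType) (q : nat) (conj : {rmorphism K -> K}).
Hypotheses (cardK : #|K| = (q ^ 2)%N) (conjE : forall x, conj x = x ^+ q).
Let q1 : (1 < q)%N := q_gt1 cardK.
Let q0 : (0 < q)%N := ltnW q1.
Local Notation adj := (adjmx conj).
Local Notation herm := (hermmx conj).
Local Notation realK := (real_set conj).
Local Notation level := (form_level conj).
Local Notation qform := (herm_form conj).

Variable m : nat.

Definition hval (A : 'M[K]_m) (v : 'rV[K]_m) (c : K) (x : 'rV[K]_m) : K :=
  qform A x + tr conj (scal (x *m adj v)) + c.

Definition hzeros A v c : nat := #|[set x | hval A v c x == 0]|.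

(** The vector 0 is left out because the coordinates of a word are indexed by the units of L. *)
Definition hweight A v c : nat := #|[set x | (x != 0) && (hval A v c x != 0)]|.

Lemma hval0 A v c : hval A v c 0 = c.
Proof. by rewrite /hval qform0 mul0mx /scal mxE /tr rmorph0 !addr0 add0r. Qed.

Lemma hval_real A v c x : herm A -> c \in realK -> hval A v c x \in realK.
Proof.
move=> hA cR; apply: real_setD => //; apply: real_setD.
  exact: (qform_real cardK conjE).
exact: (tr_real cardK conjE).
Qed.

Lemma hvalB A v c A' v' c' x :
  hval (A - A') (v - v') (c - c') x = hval A v c x - hval A' v' c' x.
Proof.
rewrite /hval /herm_form adjD adjN mulmxBr mulmxBl mulmxBr.
rewrite /tr !scalD !scalN !rmorphB; ring.
Qed.

(** The last summand accounts for x = 0, where the value is c: it is missing from the weight, and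
    from the zeros when c is nonzero. *)
Lemma hweight_zeros A v c :
  (hweight A v c + hzeros A v c + (c != 0%R) = q ^ (2 * m))%N.
Proof.
have <- : #|{: 'rV[K]_m}| = (q ^ (2 * m))%N by rewrite card_mx mul1n cardK -expnM.
rewrite -(cardsC [set x | hval A v c x == 0]) -/(hzeros A v c).
rewrite addnAC addnC; congr (_ + _)%N.
rewrite [in RHS](cardsD1 0) !inE hval0 addnC; congr (_ + _)%N.
by apply: eq_card => x; rewrite !inE.
Qed.

(** Completing the square: for v = u A the value at x is that of the form at x + u, minus the
    constant on the right. *)
Lemma hzeros_square A u c : herm A ->
  hzeros A (u *m A) c = level A (qform A u - c).
Proof.
move=> hA; rewrite /hzeros /form_level -[RHS](card_imset _ (addIr (- u))).
have vE x : hval A (u *m A) c x = qform A (x + u) - (qform A u - c).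
  rewrite (qformD cardK conjE hA) /hval adjM (eqP hA) mulmxA; ring.
apply: eq_card => x; apply/idP/imsetP=> [|[y]]; rewrite inE => hx.
  exists (x + u); last by rewrite addrK.
  by rewrite vE subr_eq0 in hx; rewrite inE.
by move=> ->; rewrite inE vE subrK subr_eq0.
Qed.

(** Some z in the kernel of A has z v' nonzero. Translation by multiples of z fixes the form and
    moves the trace term by any real amount, so all values are equally frequent. *)
Lemma hzeros_generic A v c : herm A -> ~~ (v <= A)%MS -> c \in realK ->
  (q * hzeros A v c = q ^ (2 * m))%N.
Proof.
move=> hA; rewrite submxE => nvA cR.
have col_mul n (B : 'M[K]_(n, m)) j : B *m col j (cokermx A) = col j (B *m cokermx A).
  by rewrite !colE mulmxA.
have [j vj] : exists j, v *m col j (cokermx A) != 0.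
  apply/existsP; apply: contraR nvA; rewrite negb_exists => /forallP no.
  apply/eqP/rowP=> j; have := no j; rewrite negbK col_mul => /eqP/colP/(_ 0).
  by rewrite !mxE.
(* A column of the cokernel that detects v; as A is Hermitian, its adjoint lies in the kernel. *)
pose z := adj (col j (cokermx A)).
have zk : z \in kernel A.
  by rewrite inE -(eqP hA) -adjM col_mul mulmx_coker col0 adj0.
have zv : scal (z *m adj v) != 0.
  rewrite -adjM scal_adj fmorph_eq0; apply: contra vj => /eqP s0.
  by apply/eqP/matrixP=> i k; rewrite !ord1 [RHS]mxE.
apply: (card_level_translation cardK conjE) (real_set0 conj).
  by move=> x; exact: hval_real.
move=> e eR; have [k hk] := tr_onto cardK conjE eR.
exists ((k / scal (z *m adj v)) *: z) => x.
have kz : (k / scal (z *m adj v)) *: z \in kernel A.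
  by move: zk; rewrite !inE -scalemxAl => /eqP->; rewrite scaler0.
rewrite /hval (qform_shift_kernel cardK conjE hA _ kz) mulmxDl -scalemxAl scalD.
by rewrite scalZ divfK // trD hk; ring.
Qed.

Section FixedMatrix.

Variables (A : 'M[K]_m) (G : int -> rat).
Hypothesis hA : herm A.
Let r := \rank A.
Let M : nat := (q ^ (2 * m))%N.
Let l0 := level A 0.
Let l1 := level A 1.

Lemma hweightE v c : (hweight A v c)%:Z = M%:Z - (hzeros A v c)%:Z - (c != 0)%:R.
Proof.
have := hweight_zeros A v c; rewrite -/M => <-.
by rewrite !PoszD natz; ring.
Qed.

Lemma sum_real_ne (e : K) (a : rat) : e \in realK ->
  \sum_(c in realK | c != e) a = (q%:R - 1) * a.
Proof.
move=> eR; rewrite sumr_const -[LHS]mulr_natl; congr (_ * _).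
have := cardsD1 e realK; rewrite eR (card_real cardK conjE) => qE.
rewrite [in RHS]qE natrD addrAC subrr add0r; congr _%:R.
by apply: eq_card => d; rewrite in_setD1 andbC.
Qed.

Lemma sum_weight_generic v : ~~ (v <= A)%MS ->
  \sum_(c in realK) G (hweight A v c) =
    G (M%:Z - (M %/ q)%:Z) + (q%:R - 1) * G (M%:Z - (M %/ q)%:Z - 1).
Proof.
move=> nv.
have zE c : c \in realK -> hzeros A v c = (M %/ q)%N.
  by move=> cR; rewrite /M -(hzeros_generic hA nv cR) mulKn.
rewrite (bigD1 0) ?real_set0 //= hweightE zE ?real_set0 // eqxx subr0; congr (_ + _).
rewrite -(sum_real_ne _ (real_set0 conj)); apply: eq_bigr => c /andP[cR c0].
by rewrite hweightE zE // c0.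
Qed.

(** The sum over v = u A becomes a sum over u, grouped by the value e of the form at u. The word
    then has [l0] zeros if c = e and [l1] otherwise, counting x = 0. *)
Lemma sum_weight_square :
  (q ^ (2 * (m - r)))%:R * (\sum_(v | (v <= A)%MS) \sum_(c in realK) G (hweight A v c)) =
  l0%:R * G (M%:Z - l0%:Z) + (q%:R - 1) * l1%:R * G (M%:Z - l0%:Z - 1)
  + (q%:R - 1) * l1%:R * G (M%:Z - l1%:Z)
  + (q%:R - 1) * (M%:R - l1%:R) * G (M%:Z - l1%:Z - 1).
Proof.
pose S v := \sum_(c in realK) G (hweight A v c).
(* Each v in the row space is u A for as many u as the kernel has elements. *)
have -> : (q ^ (2 * (m - r)))%:R * (\sum_(v | (v <= A)%MS) S v) = \sum_u S (u *m A).
  rewrite [RHS](partition_big (fun u => u *m A) (fun v => (v <= A)%MS)) /=; last first.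
    by move=> u _; exact: submxMl.
  rewrite mulr_sumr; apply: eq_bigr => v /submxP[w vw].
  rewrite (eq_bigr (fun _ => S v)); last by move=> u /eqP->.
  rewrite sumr_const -[RHS]mulr_natl -(card_kernel cardK); congr (_%:R * _).
  rewrite -(card_imset _ (addIr w)); apply: eq_card => u.
  rewrite -[RHS]/(u *m A == v); apply/imsetP/eqP => [[z]|uv].
    by rewrite inE => /eqP zA ->; rewrite mulmxDl zA add0r vw.
  by exists (u - w); rewrite ?subrK // inE mulmxBl uv vw subrr eqxx.
pose T e := \sum_(c in realK) G (M%:Z - (level A (e - c))%:Z - (c != 0)%:R).
have ST u : S (u *m A) = T (qform A u).
  by apply: eq_bigr => c _; rewrite hweightE hzeros_square.
rewrite (partition_big (qform A) (mem realK)) /=; last first.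
  by move=> u _; exact: (qform_real cardK conjE).
have lv e : \sum_(u | qform A u == e) S (u *m A) = (level A e)%:R * T e.
  rewrite (eq_bigr (fun _ => T e)); last by move=> u /eqP<-.
  rewrite sumr_const -[LHS]mulr_natl; congr (_%:R * _).
  by apply: eq_card => u; rewrite !inE.
under eq_bigr => e _ do rewrite lv.
have l1E e : e \in realK -> e != 0 -> level A e = l1.
  exact: (level_ne0 cardK conjE).
rewrite (bigD1 0) ?real_set0 //= -/l0.
have -> : T 0 = G (M%:Z - l0%:Z) + (q%:R - 1) * G (M%:Z - l1%:Z - 1).
  rewrite /T (bigD1 0) ?real_set0 //= eqxx !subr0; congr (_ + _).
  rewrite -(sum_real_ne _ (real_set0 conj)); apply: eq_bigr => c /andP[cR c0].
  by rewrite c0 sub0r l1E ?oppr_eq0 ?real_setN.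
(* Three kinds of c: c = 0, c = e, and the q - 2 remaining values. *)
have T1 e : e \in realK -> e != 0 -> T e = G (M%:Z - l1%:Z) + G (M%:Z - l0%:Z - 1)
    + (q%:R - 1 - 1) * G (M%:Z - l1%:Z - 1).
  move=> eR e0; rewrite /T (bigD1 0) ?real_set0 //= eqxx !subr0 l1E //.
  rewrite -addrA; congr (_ + _).
  rewrite (bigD1 e) /=; last by rewrite eR e0.
  rewrite e0 subrr; congr (_ + _).
  set a := G (_ - 1).
  rewrite mulrBl mul1r -(sum_real_ne a (real_set0 conj)) [in RHS](bigD1 e) /=; last first.
    by rewrite eR e0.
  rewrite [in RHS]addrAC subrr add0r; apply: eq_bigr => c /andP[/andP[cR c0] ce].
  by rewrite c0 l1E ?real_setD ?real_setN // subr_eq0 eq_sym.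
rewrite (eq_bigr (fun _ => l1%:R * (G (M%:Z - l1%:Z) + G (M%:Z - l0%:Z - 1)
    + (q%:R - 1 - 1) * G (M%:Z - l1%:Z - 1)))); last first.
  by move=> e /andP[eR e0]; rewrite l1E // T1.
rewrite sum_real_ne ?real_set0 //.
(* This turns the coefficient [l0] + (q - 2) [l1] into M - [l1]. *)
have -> : M%:R = l0%:R + (q%:R - 1) * l1%:R :> rat.
  by rewrite /M -(sum_level cardK conjE hA) natrD natrM natrB.
ring.
Qed.

End FixedMatrix.

End Words.

(** * Weights summed over all triples, and the minimum weight *)

Section WeightSums.

Variables (K : finFieldType) (q : nat) (conj : {rmorphism K -> K}).
Hypotheses (cardK : #|K| = (q ^ 2)%N) (conjE : forall x, conj x = x ^+ q).
Let q1 : (1 < q)%N := q_gt1 cardK.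
Let q0 : (0 < q)%N := ltnW q1.
Local Notation herm := (hermmx conj).
Local Notation realK := (real_set conj).
Local Notation level := (form_level conj).

Variable m : nat.
Hypothesis m_gt0 : (0 < m)%N.

(** Factors of equal index in the two products of f_j form a difference of squares, (-q)^(2i) -
    q^(2m). *)
Lemma herm_rank_poly_f j : herm_rank_poly (- q%:R) (q%:R ^+ (2 * m)) j = f_ q m j.
Proof.
rewrite /f_ !big_mkord -big_split /=; apply: eq_bigr => i _.
have sq k : (-1) ^+ (k + 1) * q%:R ^+ k = - (- q%:R) ^+ k :> rat.
  by rewrite [in RHS]exprNn exprD expr1 mulrN1 mulNr.
have -> : q%:R ^+ (2 * m) = ((- q%:R) ^+ m) ^+ 2 :> rat.
  by rewrite [in RHS]exprNn exprMn sqrr_sign mul1r -exprM mulnC.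
rewrite !sq mulnC exprM; ring.
Qed.

Lemma herm_count_f j : (herm_count conj m j)%:R = f_ q m j.
Proof. by rewrite (herm_count_rank_poly cardK conjE) herm_rank_poly_f. Qed.

Lemma expz_double : q%:Z ^+ (2 * m) = q%:Z * q%:Z ^+ (2 * m - 1).
Proof. by rewrite -exprS; congr (_ ^+ _); lia. Qed.

Section Rank.

Variable A : 'M[K]_m.
Hypothesis hA : herm A.
Let r := \rank A.

Lemma level0E : (level A 0)%:Z =
  q%:Z ^+ (2 * m - 1) + (-1) ^+ r * q%:Z ^+ (2 * m - r - 1) * (q%:Z - 1).
Proof.
have rm : (r <= m)%N by exact: rank_leq_row.
have qz : q%:Z != 0 by rewrite -lt0n.
apply: (mulfI qz); rewrite (levelE cardK conjE hA) ?real_set0 // eqxx expz_double.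
have e : (2 * m - \rank A = (2 * m - r - 1).+1)%N by rewrite /r in rm *; lia.
by rewrite [in LHS]e exprS /r /= mulr1; ring.
Qed.

Lemma level1E : (level A 1)%:Z =
  q%:Z ^+ (2 * m - 1) - (-1) ^+ r * q%:Z ^+ (2 * m - r - 1).
Proof.
have rm : (r <= m)%N by exact: rank_leq_row.
have qz : q%:Z != 0 by rewrite -lt0n.
apply: (mulfI qz); rewrite (levelE cardK conjE hA) ?real_set1 // oner_eq0 expz_double.
have e : (2 * m - \rank A = (2 * m - r - 1).+1)%N by rewrite /r in rm *; lia.
by rewrite [in LHS]e exprS /r /= mulr0; ring.
Qed.

(** The contribution of one v outside the row space, summed over c. *)
Definition generic_sum (G : int -> rat) : rat := G (w0 q m) + (q%:R - 1) * G (w0 q m - 1).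

Lemma w0E : w0 q m = (q ^ (2 * m))%N%:Z - (q ^ (2 * m) %/ q)%N%:Z.
Proof.
rewrite /w0 PoszX; congr (_ - _).
have -> : (2 * m = (2 * m - 1).+1)%N by lia.
by rewrite expnS mulKn // PoszX subn1.
Qed.

Lemma sum_weight_split (G : int -> rat) : \sum_v \sum_(c in realK) G (hweight conj A v c) =
  (q%:R ^+ (2 * m) - q%:R ^+ (2 * r)) * generic_sum G +
  \sum_(v | (v <= A)%MS) \sum_(c in realK) G (hweight conj A v c).
Proof.
rewrite (bigID (fun v : 'rV_m => (v <= A)%MS)) /= addrC; congr (_ + _).
rewrite (eq_bigr (fun _ => generic_sum G)); last first.
  by move=> v nv; rewrite (sum_weight_generic cardK conjE) // /generic_sum w0E.
rewrite sumr_const -[LHS]mulr_natl; congr (_ * _).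
have := cardsC [set v : 'rV[K]_m | (v <= A)%MS].
rewrite -{1}/(rowg A) card_rowg card_mx mul1n cardK -!expnM.
move/(congr1 (fun k => k%:R : rat)); rewrite natrD !natrX => <-; rewrite addrAC subrr add0r.
by congr _%:R; apply: eq_card => v; rewrite !inE.
Qed.

(** These are the listed frequencies without the factor f_r. Positivity of r keeps the exponents 2r
    - 1 and r - 1 from being truncated. *)
Lemma sum_weight_rank_pos (G : int -> rat) : (0 < r)%N ->
  \sum_v \sum_(c in realK) G (hweight conj A v c) =
  (q%:R ^+ (2 * m) - q%:R ^+ (2 * r)) * generic_sum G +
  (G (w0 q m - (-1) ^+ r * q%:Z ^+ (2 * m - r - 1) * (q%:Z - 1)) *
     (q%:R ^+ (2 * r - 1) + (-1) ^+ r * q%:R ^+ (r - 1) * (q%:R - 1))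
  + G (w0 q m - 1 - (-1) ^+ r * q%:Z ^+ (2 * m - r - 1) * (q%:Z - 1)) *
     ((q%:R ^+ (2 * r - 1) - (-1) ^+ r * q%:R ^+ (r - 1)) * (q%:R - 1))
  + G (w0 q m + (-1) ^+ r * q%:Z ^+ (2 * m - r - 1)) *
     ((q%:R ^+ (2 * r - 1) - (-1) ^+ r * q%:R ^+ (r - 1)) * (q%:R - 1))
  + G (w0 q m - 1 + (-1) ^+ r * q%:Z ^+ (2 * m - r - 1)) *
     ((q%:R ^+ (2 * r) - q%:R ^+ (2 * r - 1) + (-1) ^+ r * q%:R ^+ (r - 1)) *
         (q%:R - 1))).
Proof.
move=> r0; have rm : (r <= m)%N by exact: rank_leq_row.
rewrite sum_weight_split; congr (_ + _).
have a0 : (q ^ (2 * (m - r)))%:R != 0 :> rat by rewrite pnatr_eq0 -lt0n expn_gt0 q0.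
apply: (mulfI a0); rewrite (sum_weight_square cardK conjE) // level0E level1E -/r.
have l0R : (level A 0)%:R = (level A 0)%:Z%:~R :> rat by [].
have l1R : (level A 1)%:R = (level A 1)%:Z%:~R :> rat by [].
rewrite l0R l1R level0E level1E -/r PoszX /w0.
have e1 : q%:R ^+ (2 * m - 1) = q%:R ^+ (2 * (m - r)) * q%:R ^+ (2 * r - 1) :> rat.
  by rewrite -exprD; congr (_ ^+ _); lia.
have e2 : q%:R ^+ (2 * m - r - 1) = q%:R ^+ (2 * (m - r)) * q%:R ^+ (r - 1) :> rat.
  by rewrite -exprD; congr (_ ^+ _); lia.
have e3 : q%:R ^+ (2 * m) = q%:R ^+ (2 * (m - r)) * q%:R ^+ (2 * r) :> rat.
  by rewrite -exprD; congr (_ ^+ _); lia.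
rewrite !natrX !rmorphD !rmorphN !rmorphM !rmorphXn /= !rmorphN1 e1 e2 e3.
set W := _ ^+ (2 * m); set W' := _ ^+ (2 * m - 1); set P := (-1) ^+ r * _ ^+ (2 * m - r - 1).
(* The arguments of [G] are first put in the form of the list, since [ring] does not rewrite inside
   them. *)
have -> : W - (W' + P * (q%:Z - 1)) = W - W' - P * (q%:Z - 1) by ring.
have -> : W - W' - P * (q%:Z - 1) - 1 = W - W' - 1 - P * (q%:Z - 1) by ring.
have -> : W - (W' - P) = W - W' + P by ring.
have -> : W - W' + P - 1 = W - W' - 1 + P by ring.
ring.
Qed.

(** Here A = 0, so only v = 0 lies in the row space, and it gives the constant words of weight 0 and
    q^(2m) - 1. *)
Lemma sum_weight_rank0 (G : int -> rat) : r = 0%N ->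
  \sum_v \sum_(c in realK) G (hweight conj A v c) =
  (q%:R ^+ (2 * m) - 1) * generic_sum G +
  (G 0 + (q%:R - 1) * G (q%:Z ^+ (2 * m) - 1)).
Proof.
move=> r0; rewrite sum_weight_split r0 muln0 expr0; congr (_ + _).
have a0 : (q ^ (2 * (m - r)))%:R != 0 :> rat by rewrite pnatr_eq0 -lt0n expn_gt0 q0.
apply: (mulfI a0); rewrite (sum_weight_square cardK conjE) //.
have l1E : (level A 1)%:Z = 0.
  by rewrite level1E r0 expr0 mul1r subn0 subrr.
have l0E : (level A 0)%:Z = q%:Z ^+ (2 * m).
  by rewrite level0E r0 expr0 mul1r subn0 expz_double; ring.
have l0R : (level A 0)%:R = (level A 0)%:Z%:~R :> rat by [].
have l1R : (level A 1)%:R = (level A 1)%:Z%:~R :> rat by [].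
rewrite l0R l1R l0E l1E PoszX subrr !subr0 -/r r0 subn0 natrX rmorphXn /=.
ring.
Qed.

End Rank.

(** With [G] the indicator of a weight this is the weight distribution; a general [G] allows entries
    of the list to share a weight. *)
Theorem sum_all_weights (G : int -> rat) :
  \sum_(A : 'M[K]_m | herm A) \sum_v \sum_(c in realK) G (hweight conj A v c) =
  \sum_(e <- weight_entries q m) G e.1 * e.2.
Proof.
pose Y j := \sum_(e <- weight_entries_at q m j) G e.1 * e.2.
(* The contribution of a single matrix of rank j; dividing by f_j removes the number of such
   matrices from the listed frequencies. *)
pose X j := if j == 0%N then (q%:R ^+ (2 * m) - 1) * generic_sum G +
    (G 0 + (q%:R - 1) * G (q%:Z ^+ (2 * m) - 1))
  else (q%:R ^+ (2 * m) - q%:R ^+ (2 * j)) * generic_sum G + Y j / f_ q m j.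
have AX (A : 'M[K]_m) : herm A ->
    \sum_v \sum_(c in realK) G (hweight conj A v c) = X (\rank A).
  move=> hA; rewrite /X; case: eqP => [r0|/eqP rn0]; first exact: (sum_weight_rank0 hA G r0).
  have f0 : f_ q m (\rank A) != 0.
    rewrite -herm_count_f pnatr_eq0 -lt0n; apply/card_gt0P; exists A.
    by rewrite inE hA eqxx.
  rewrite (sum_weight_rank_pos hA G) ?lt0n //; congr (_ + _); apply: (mulIf f0).
  rewrite divfK // /Y /weight_entries_at !big_cons big_nil /=; ring.
rewrite (eq_bigr _ AX) sum_herm_rank.
rewrite -(big_mkord xpredT (fun j => (herm_count conj m j)%:R * X j)).
under eq_bigr => j _ do rewrite herm_count_f.
rewrite big_ltn // -[f_ q m 0]herm_count_f (herm_count_rank_poly cardK conjE).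
rewrite herm_rank_poly0 mul1r.
(* If f_j = 0 both sides vanish, as f_j divides every frequency in [Y j]. *)
have fY j : f_ q m j * (Y j / f_ q m j) = Y j.
  have [f0|f0] := eqVneq (f_ q m j) 0; last by rewrite mulrC divfK.
  rewrite f0 mul0r /Y /weight_entries_at !big_cons big_nil /= f0.
  by rewrite !mulr0 !addr0.
rewrite (eq_big_nat _ _ (F2 := fun j =>
   (q%:R ^+ (2 * m) - q%:R ^+ (2 * j)) * f_ q m j * generic_sum G + Y j)); last first.
  by move=> [|j] // _; rewrite /X /= mulrDr fY; congr (_ + _); ring.
rewrite big_split /= -mulr_suml /weight_entries big_cat !big_cons big_nil /=.
rewrite big_flatten big_map /= /f_sum.
have -> : iota 1 m = index_iota 1 m.+1 by rewrite /index_iota subn1.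
rewrite -/Y /X /= /generic_sum; set S := \sum_(1 <= i < m.+1) (_ * _).
ring.
Qed.

Let d := (q ^ (2 * m - 2) * (q ^ 2 - q - 1) - 1)%N.

Lemma expn_double_pred : (q ^ (2 * m - 1) = q * q ^ (2 * m - 2))%N.
Proof. by rewrite -expnS; congr (_ ^ _)%N; lia. Qed.

(** The largest surplus over q^(2m-1) comes from rank 1 at a nonzero value of e, where it is exactly
    q^(2m-2). *)
Lemma hzeros_le (A : 'M[K]_m) v c : herm A -> c \in realK -> (A, v, c) != (0, 0, 0) ->
  (hzeros conj A v c <= q ^ (2 * m - 1) + q ^ (2 * m - 2))%N.
Proof.
move=> hA cR nz; have [vA|vA] := boolP (v <= A)%MS; last first.
  have := hzeros_generic cardK conjE hA vA cR.
  have -> : (q ^ (2 * m) = q * q ^ (2 * m - 1))%N.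
    by rewrite -expnS; congr (_ ^ _)%N; lia.
  by move/eqP; rewrite eqn_pmul2l // => /eqP->; exact: leq_addr.
case/submxP: vA => u vE; rewrite vE (hzeros_square cardK conjE) //.
set e := _ - c.
have eR : e \in realK.
  by apply: real_setD; [exact: (qform_real cardK conjE)|exact: real_setN].
have rm := rank_leq_row A.
have q1Z : (1 : int) < q%:Z by [].
have pw (k : nat) : (0 < k)%N -> (k <= m)%N -> q%:Z ^+ (2 * m - k - 1) <= q%:Z ^+ (2 * m - 2).
  by move=> k0 km; rewrite ler_eXn2l //; lia.
rewrite -lez_nat PoszD !PoszX.
have [e0|e0] := eqVneq e 0; last first.
  rewrite (level_ne0 cardK conjE _ eR e0) level1E //.
  have [r0|r0] := posnP (\rank A).
    by rewrite r0 expr0 mul1r subn0 subrr addr_ge0 ?exprn_ge0.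
  rewrite lerD2l; have := pw _ r0 rm.
  have := exprn_ge0 (2 * m - \rank A - 1) (ltW (lt_trans ltr01 q1Z)).
  by rewrite -signr_odd; case: odd; rewrite ?expr0 ?expr1 ?mul1r ?mulN1r; lia.
rewrite e0 level0E //.
have [r0|r0] := posnP (\rank A).
  (* Rank 0 together with e = 0 would make the whole triple zero. *)
  exfalso; move/eqP: r0; rewrite mxrank_eq0 => /eqP A0.
  move: nz e0; rewrite vE /e /herm_form A0 !mulmx0 !mul0mx /scal mxE sub0r.
  by move=> nz /eqP; rewrite oppr_eq0 => /eqP c0; rewrite c0 eqxx in nz.
rewrite lerD2l -signr_odd; have [ro|re] := boolP (odd (\rank A)).
  rewrite expr1 mulN1r mulNr; apply: le_trans (_ : 0 <= _).
    by rewrite oppr_le0 mulr_ge0 ?exprn_ge0 // subr_ge0 ltW.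
  exact: exprn_ge0.
rewrite expr0 mul1r.
(* A positive even rank is at least 2, so the surplus q^(2m-r-1) (q - 1) stays below q^(2m-2). *)
have r2 : (1 < \rank A)%N by case: (\rank A) r0 re => [|[]].
apply: le_trans (_ : q%:Z ^+ (2 * m - 3) * q%:Z <= _).
  apply: ler_pM; [exact: exprn_ge0 | by rewrite subr_ge0 ltW | |].
    by rewrite ler_eXn2l //; lia.
  by rewrite gerBl.
by rewrite -exprSr ler_eXn2l //; lia.
Qed.

Lemma hweight_of_zeros (A : 'M[K]_m) v c :
  (hweight conj A v c + hzeros conj A v c + (c != 0%R) = q * (q * q ^ (2 * m - 2)))%N.
Proof.
rewrite (hweight_zeros _ cardK) -!expnS; congr (_ ^ _)%N; lia.
Qed.

Lemma hweight_ge (A : 'M[K]_m) v c : herm A -> c \in realK -> (A, v, c) != (0, 0, 0) ->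
  (d <= hweight conj A v c)%N.
Proof.
move=> hA cR nz; have := hweight_of_zeros A v c; have := hzeros_le hA cR nz.
rewrite expn_double_pred /d; move: (q ^ (2 * m - 2))%N => B; rewrite -mulnn.
by case: (c != 0); move: (hweight _ _ _ _) (hzeros _ _ _ _) => x y /=; nia.
Qed.

(** A rank 1 matrix with v = 0 and c = 1 attains the maximal number of zeros, and c being nonzero
    lowers the weight by one more. *)
Lemma hweight_attained : exists (A : 'M[K]_m) v c,
  [/\ herm A, c \in realK, (A, v, c) != (0, 0, 0) & hweight conj A v c = d].
Proof.
pose i0 := Ordinal m_gt0; pose A : 'M[K]_m := delta_mx i0 i0.
have hA : herm A.
  by apply/eqP; rewrite /adjmx map_delta_mx trmx_delta.
exists A, 0, 1; split=> //; first exact: real_set1.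
  by apply/eqP=> -[_ /eqP]; rewrite oner_eq0.
have := hweight_of_zeros A 0 1.
rewrite -(mul0mx _ A) (hzeros_square cardK conjE) // qform0 sub0r.
rewrite (level_ne0 cardK conjE) ?oppr_eq0 ?oner_eq0 ?real_setN ?real_set1 //.
have -> : level A 1 = (q ^ (2 * m - 1) + q ^ (2 * m - 2))%N.
  apply/eqP; rewrite -eqz_nat PoszD !PoszX level1E // mxrank_delta expr1 mulN1r opprK.
  by rewrite -subnDA.
rewrite expn_double_pred /d; move: (q ^ (2 * m - 2))%N => B; rewrite -mulnn.
by move: (hweight _ _ _ _) => x /=; nia.
Qed.

End WeightSums.

(** * Annihilators of words modulo 'X^n - 1 *)

Section FrobeniusPower.

Variables (R : comNzRingType) (q : nat).

(** Taking the proof as an argument lets the ring morphism structure be attached to the function. *)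
Definition frob_pow of [pchar R].-nat q := fun x : R => x ^+ q.

Variable charRq : [pchar R].-nat q.

Fact frob_pow_is_zmod_morphism : zmod_morphism (frob_pow charRq).
Proof. by move=> x y; rewrite /frob_pow exprDn_pchar // exprNn_pchar. Qed.

Fact frob_pow_is_monoid_morphism : monoid_morphism (frob_pow charRq).
Proof. by split=> [|x y]; rewrite /frob_pow ?expr1n ?exprMn. Qed.

HB.instance Definition _ := GRing.isZmodMorphism.Build R R (frob_pow charRq)
  frob_pow_is_zmod_morphism.
HB.instance Definition _ := GRing.isMonoidMorphism.Build R R (frob_pow charRq)
  frob_pow_is_monoid_morphism.

End FrobeniusPower.

Lemma pchar_nat_card (F : finFieldType) : [pchar F].-nat #|F|.
Proof.
have [p p_pr charFp] := finPcharP F.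
have cF : #|F| = (p ^ _)%N := card_pprimeChar charFp.
by rewrite cF pnatX pnatE // charFp.
Qed.

Section CyclicCode.

Variables (F : finFieldType) (n : nat) (h : {poly F}).
Hypothesis n_gt0 : (0 < n)%N.

(** This makes sense before h is known to divide X^n - 1; once it does, this is the ideal generated
    by the quotient. *)
Definition annihilated : {set 'rV[F]_n} := [set w | 'X^n - 1 %| rVpoly w * h].

Let size_Xn1 : size ('X^n - 1 : {poly F}) = n.+1.
Proof. by rewrite size_XnsubC. Qed.

Let Xn1_neq0 : 'X^n - 1 != 0 :> {poly F}.
Proof. by rewrite -size_poly_gt0 size_Xn1. Qed.

(** With D the gcd, an annihilated word is a multiple of (X^n - 1)/D, and the quotient has degree
    less than that of D. *)
Lemma card_annihilated :
  (#|annihilated| <= #|F| ^ (size (gcdp ('X^n - 1) h)).-1)%N.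
Proof.
set D := gcdp _ _; pose g := ('X^n - 1) %/ D; pose k := (size D).-1.
have D0 : D != 0 by rewrite gcdp_eq0 negb_and Xn1_neq0.
have gD : g * D = 'X^n - 1 by rewrite divpK ?dvdp_gcdl.
have g0 : g != 0 by apply: contraNneq Xn1_neq0 => g0; rewrite -gD g0 mul0r.
have gdvd w : w \in annihilated -> g %| rVpoly w.
  rewrite inE -gD -[in X in _ %| X -> _](divpK (dvdp_gcdr ('X^n - 1) h)) -/D.
  rewrite mulrA dvdp_mul2r // Gauss_dvdpl // coprimep_div_gcd //.
  by rewrite Xn1_neq0.
pose f (w : 'rV[F]_n) : 'rV[F]_k := poly_rV (rVpoly w %/ g).
have szq w : w \in annihilated -> (size (rVpoly w %/ g)%R <= k)%N.
  move=> _; rewrite size_divp //.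
  have := size_mul g0 D0; rewrite gD size_Xn1.
  have := size_poly_gt0 D; rewrite D0; have := size_poly_gt0 g; rewrite g0 /k.
  have : (size (rVpoly w) <= n)%N by exact: size_poly.
  by move: (size (rVpoly w)) (size g) (size D) => a b c; lia.
have injf : {in annihilated &, injective f}.
  move=> w w' wA w'A /(congr1 rVpoly); rewrite !poly_rV_K ?szq // => e.
  by apply: (can_inj rVpolyK); rewrite -(divpK (gdvd w wA)) e divpK ?gdvd.
rewrite -(card_in_imset injf); apply: leq_trans (max_card _) _.
by rewrite card_mx mul1n.
Qed.

(** The size of [W] forces the gcd of h and X^n - 1 to have degree at least k, while h has degree at
    most k. So the gcd is h up to a unit, and [W] fills the annihilator. *)
Lemma cyclic_ideal_of_annihilated (W : {set 'rV[F]_n}) (k : nat) :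
    h \is monic -> (size h <= k.+1)%N -> (#|F| ^ k <= #|W|)%N ->
    W \subset annihilated ->
  [/\ h %| 'X^n - 1, cyclic_ideal n (('X^n - 1) %/ h) =i W & #|W| = (#|F| ^ k)%N].
Proof.
move=> hmon szh cW sW; set D := gcdp ('X^n - 1) h.
have h0 : h != 0 by exact: monic_neq0.
have leD : (k <= (size D).-1)%N.
  rewrite -(leq_exp2l _ _ (finNzRing_gt1 F)); apply: leq_trans cW _.
  exact: leq_trans (subset_leq_card sW) card_annihilated.
have dvDh : D %| h := dvdp_gcdr _ _.
have szD : size D = size h.
  apply/eqP; rewrite eqn_leq dvdp_leq //; apply: leq_trans szh _.
  by have : (0 < size D)%N; [rewrite size_poly_gt0 gcdp_eq0 negb_and Xn1_neq0 | lia].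
have eqDh : D %= h by rewrite -(dvdp_size_eqp dvDh) szD.
have hdvd : h %| 'X^n - 1 by rewrite -(eqp_dvdl _ eqDh) dvdp_gcdl.
have cA : (#|annihilated| <= #|F| ^ k)%N.
  apply: leq_trans card_annihilated _; rewrite leq_exp2l ?finNzRing_gt1 //.
  by rewrite -/D szD; lia.
have eW : W = annihilated.
  by apply/eqP; rewrite eqEcard sW (leq_trans cA cW).
split=> //; last by apply/eqP; rewrite eqn_leq cW andbT eW.
move=> w; rewrite eW inE; set g := _ %/ h.
have gh : g * h = 'X^n - 1 by rewrite divpK.
apply/(cyclic_idealP g w n_gt0)/idP=> [[a ->]|].
  have : 'X^n - 1 %| a * g * h by rewrite -mulrA gh dvdp_mull.
  by rewrite {1}(divp_eq (a * g) ('X^n - 1)) mulrDl dvdp_addr // mulrAC dvdp_mull.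
rewrite -{1}gh dvdp_mul2r // => /divpK wg; exists (rVpoly w %/ g).
by rewrite wg modp_small // size_Xn1 ltnS size_poly.
Qed.

End CyclicCode.

Section WordPolynomial.

Variables (L : fieldType) (n : nat) (z : L) (h : {poly L}).
Hypotheses (n_gt0 : (0 < n)%N) (zn : z ^+ n = 1).

Definition word_poly (f : L -> L) : {poly L} := \poly_(i < n) f (z ^+ i).
Definition killed f : bool := 'X^n - 1 %| word_poly f * h.

Lemma word_poly_ext f g : f =1 g -> word_poly f = word_poly g.
Proof. by move=> fg; apply/polyP=> i; rewrite !coef_poly fg. Qed.

Lemma killed_ext f g : f =1 g -> killed f -> killed g.
Proof. by rewrite /killed => /word_poly_ext->. Qed.

Lemma killedD f g : killed f -> killed g -> killed (fun x => f x + g x).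
Proof.
move=> kf kg; rewrite /killed.
have -> : word_poly (fun x => f x + g x) = word_poly f + word_poly g.
  by apply/polyP=> k; rewrite coefD !coef_poly; case: ifP; rewrite ?addr0.
by rewrite mulrDl dvdp_add.
Qed.

Lemma killedZ f a : killed f -> killed (fun x => f x * a).
Proof.
move=> kf; rewrite /killed.
have -> : word_poly (fun x => f x * a) = a%:P * word_poly f.
  by apply/polyP=> k; rewrite coefCM !coef_poly; case: ifP; rewrite ?mulr0 // mulrC.
by rewrite -mulrA dvdp_mull.
Qed.

Lemma killed_sum (I : Type) (r : seq I) (f : I -> L -> L) :
  (forall i, killed (f i)) -> killed (fun x => \sum_(i <- r) f i x).
Proof.
move=> kf; elim: r => [|i r IH].
  rewrite /killed (_ : word_poly _ = 0) ?mul0r ?dvdp0 //.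
  by apply/polyP=> k; rewrite coef_poly big_nil coef0 if_same.
by apply: killed_ext (killedD (kf i) IH) => x; rewrite big_cons.
Qed.

(** With b = z^e the word is a geometric sum in b X, and multiplying it by b X - 1 gives (b X)^n - 1
    = X^n - 1. The root supplies that linear factor of h. *)
Lemma killed_pow e : root h (z ^- e) -> killed (fun x => x ^+ e).
Proof.
case/factor_theorem=> h' hE; rewrite /killed hE.
set b := z ^+ e.
have bn : b ^+ n = 1 by rewrite /b exprAC zn expr1n.
have b0 : b != 0.
  by apply: contra_eq_neq bn => ->; rewrite expr0n gtn_eqF // eq_sym oner_eq0.
have -> : word_poly (fun x => x ^+ e) = \sum_(i < n) (b *: 'X) ^+ i.
  rewrite /word_poly poly_def; apply: eq_bigr => i _.
  by rewrite exprZn exprAC.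
have -> : 'X - (z ^- e)%:P = b^-1 *: (b *: 'X - 1).
  by rewrite scalerBr scalerA mulVf // scale1r alg_polyC.
rewrite mulrCA; apply: dvdp_mull; rewrite -scalerAr -mul_polyC; apply: dvdp_mull.
by rewrite mulrC -subrX1 exprZn bn scale1r.
Qed.

End WordPolynomial.

(** * Frobenius on roots, the quadratic subfield, and cardinalities *)

Lemma root_map_frob_pow (F : finFieldType) (L : fieldExtType F) (p : {poly F}) (x : L) k :
  root (map_poly (in_alg L) p) x -> root (map_poly (in_alg L) p) (x ^+ (#|F| ^ k)).
Proof.
have charL : [pchar L].-nat #|F|.
  by apply: etrans (pchar_nat_card F); apply: eq_pnat => i; rewrite pchar_lalg.
elim: k x => [|k IH] x px; first by rewrite expn0 expr1.
rewrite expnSr exprM -/(frob_pow charL _); move: {IH px}(IH x px) => /rootP px.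
apply/rootP.
(* The coefficients lie in F, so the Frobenius map fixes them. *)
have -> : map_poly (in_alg L) p = map_poly (frob_pow charL) (map_poly (in_alg L) p).
  rewrite -map_poly_comp; apply: eq_map_poly => a /=.
  by rewrite /frob_pow -[RHS](rmorphXn (in_alg L)) expf_card.
by rewrite horner_map /= px rmorph0.
Qed.

Lemma size_prod_seq_leq_const (R : idomainType) (I : Type) (r : seq I) (p : I -> {poly R}) c :
  (forall i, size (p i) <= c.+1)%N -> (size (\prod_(i <- r) p i)%R <= (size r * c).+1)%N.
Proof.
move=> sp; elim: r => [|i r IH]; first by rewrite big_nil size_poly1.
rewrite big_cons; apply: leq_trans (size_polyMleq _ _) _.
rewrite mulSn -!subn1 leq_subLR; apply: leq_trans (leq_add (sp i) IH) _.
by rewrite addSn add1n addnS.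
Qed.

(** The Galois group is cyclic of order 2m; the square of a generator has order m, so its fixed
    field has degree 2. *)
Lemma quadratic_subfield (F : finFieldType) (L : fieldExtType F) m :
  (0 < m)%N -> \dim {:L} = (2 * m)%N -> exists E : {subfield L}, \dim E = 2%N.
Proof.
move=> m0; suff H (gL : splittingFieldType F) :
    \dim {:gL} = (2 * m)%N -> exists E : {subfield gL}, \dim E = 2%N.
  exact: (H (FinSplittingFieldType F L)).
move=> dimL; have galL := finField_galois (sub1v {:gL}%AS).
have [alpha /eqP defG _] := finField_galois_generator (sub1v {:gL}%AS).
have oa : #[alpha]%g = (2 * m)%N.
  by rewrite orderE -defG -(galois_dim galL) dimv1 divn1.
pose E := fixedField <[alpha ^+ 2]>%g; exists [aspace of E] => /=.
have cE : (\dim_E {:gL} = m)%N.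
  rewrite -(dim_fixedField <[alpha ^+ 2]>%G) -orderE orderXdiv oa ?dvdn_mulr //.
  by rewrite mulKn.
have := dim_sup_field (subvf [aspace of E]); rewrite /= cE dimL mulnC.
by move/eqP; rewrite eqn_pmul2l // => /eqP.
Qed.

Lemma card_finvect (F : finFieldType) (V : vectType F) :
  #|finvect_type V| = (#|F| ^ \dim {:V})%N.
Proof.
by rewrite -(card_vspacef (Vector.class (finvect_type V : vectType F))) card_vspace.
Qed.

Lemma card_code (F : finFieldType) n (C : {vspace 'rV[F]_n}) :
  #|[set c | c \in C]| = (#|F| ^ \dim C)%N.
Proof.
by rewrite -(@card_vspace F _ (Vector.class ('rV[F]_n : vectType F)) C) cardsE.
Qed.

(** * The words in the code *)

Section ExtensionField.

Variables (F : finFieldType) (L : fieldExtType F) (q m : nat) (z : L) (E : {subfield L}).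
Hypotheses (hq : #|F| = q) (m_gt0 : (0 < m)%N) (m_even : ~~ odd m).
Hypotheses (dimL : \dim {:L} = (2 * m)%N) (hz : generates_units z) (dimE : \dim E = 2%N).

Let n := (q ^ (2 * m) - 1)%N.
Let LL : finFieldType := finvect_type L.
Let K : finFieldType := finvect_type (subvs_of E).
Let iota : {rmorphism K -> L} := vsval.

Let q1 : (1 < q)%N.
Proof. by rewrite -hq finNzRing_gt1. Qed.

Let q0 : (0 < q)%N := ltnW q1.

Lemma card_extension : #|LL| = (q ^ (2 * m))%N.
Proof. by rewrite card_finvect dimL hq. Qed.

Lemma card_subfield : #|K| = (q ^ 2)%N.
Proof. by rewrite card_finvect dimvf hq -dimE. Qed.

Let n_gt0 : (0 < n)%N.
Proof. by rewrite subn_gt0 -[1%N](expn0 q) ltn_exp2l //; lia. Qed.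

Lemma pchar_extension k : [pchar L].-nat (q ^ k)%N.
Proof.
rewrite pnatX; apply/orP; left; rewrite -hq.
by apply: etrans (pchar_nat_card F); apply: eq_pnat => i; rewrite pchar_lalg.
Qed.

Lemma pchar_subfield : [pchar K].-nat q.
Proof. by have := pchar_nat_card K; rewrite card_subfield pnatX orbF. Qed.

Let conj : {rmorphism K -> K} := frob_pow pchar_subfield.

Lemma conj_powE x : conj x = x ^+ q. Proof. by []. Qed.

Lemma exp_cardL (y : L) : y ^+ (q ^ (2 * m)) = y.
Proof. by rewrite -card_extension (expf_card (y : LL)). Qed.

Lemma generator_neq0 : z != 0. Proof. by case: hz. Qed.

Lemma generator_expn : z ^+ n = 1.
Proof.
apply: (mulfI generator_neq0); rewrite -exprS mulr1 /n subn1 prednK ?expn_gt0 ?q0 //.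
exact: exp_cardL.
Qed.

Lemma powers_onto (y : L) : y != 0 -> exists i : 'I_n, z ^+ i = y.
Proof.
move=> y0; have [_ /(_ y y0)[k ->]] := hz.
have k0 : (0 <= k %% n)%Z by rewrite modz_ge0 // -lt0n.
have kn : (`|(k %% n)%Z| < n)%N.
  by rewrite -ltz_nat gez0_abs // ltz_pmod.
exists (Ordinal kn) => /=.
rewrite [in RHS](divz_eq k n) expfzDr ?generator_neq0 // [(_ * n%:Z)%R]mulrC.
rewrite -exprz_exp -exprnP generator_expn exp1rz mul1r.
by rewrite -{2}(gez0_abs k0).
Qed.

Lemma memE_frob k (a : K) : iota a ^+ (q ^ (2 * k)) = iota a.
Proof.
have aE : iota a ^+ (q ^ 2) = iota a.
  by apply/eqP; have := subvsP (a : subvs_of E); rewrite Fermat's_little_theorem dimE hq.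
by elim: k => [|k IH]; rewrite ?expr1 // mulnS expnD exprM aE.
Qed.

(** Only spanning is recorded; uniqueness of coordinates follows from |K^m| = |L|. *)
Lemma basis_exists : exists e : 'I_m -> L,
  forall y : L, exists x : 'rV[K]_m, y = \sum_k iota (x 0 k) * e k.
Proof.
have dimEL : \dim_E {:L} = m by rewrite dimL dimE mulKn.
have [X _] := field_module_semisimple (subvf (E * {:L})).
move: X; rewrite dimEL => X /= [defL _].
exists (fun k => X`_k) => y; have : y \in {:L}%VS by exact: memvf.
rewrite -{1}defL => /memv_sumP[w wE ->].
have wk k : exists a : K, w k = iota a * X`_k.
  have /memv_cosetP[a aE ->] := wE k isT.
  by exists (vsproj E a); rewrite /iota /= vsprojK.
have [a aE] := fin_all_exists wk.
by exists (\row_k a k); apply: eq_bigr => k _; rewrite mxE.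
Qed.

Section Basis.

Variable e : 'I_m -> L.
Hypothesis e_onto : forall y : L, exists x : 'rV[K]_m, y = \sum_k iota (x 0 k) * e k.

Definition comb (x : 'rV[K]_m) : L := \sum_k iota (x 0 k) * e k.
(** The default 0 is never taken, since e spans L. *)
Definition coords (y : L) : 'rV[K]_m := odflt 0 [pick x | comb x == y].

Lemma coordsK : cancel coords comb.
Proof.
move=> y; rewrite /coords; case: pickP => [x /eqP //|no].
by have [x yx] := e_onto y; have := no x; rewrite yx eqxx.
Qed.

Lemma combK : cancel comb coords.
Proof.
have cardV : #|{: 'rV[K]_m}| = #|LL|.
  by rewrite card_mx mul1n card_subfield -expnM card_extension.
have inj : injective (coords : LL -> 'rV[K]_m) := can_inj coordsK.
have bij : bijective (coords : LL -> 'rV[K]_m).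
  by apply: inj_card_bij inj _; rewrite cardV.
by apply/(bij_can_sym bij); exact: coordsK.
Qed.

Lemma comb_eq0 x : (comb x == 0) = (x == 0).
Proof.
have c0 : comb 0 = 0 by rewrite /comb big1 // => k _; rewrite mxE rmorph0 mul0r.
by rewrite -(inj_eq (can_inj combK) x) c0.
Qed.

Definition moore : 'M[L]_m := \matrix_(k, s) e k ^+ (q ^ (2 * s)).

Lemma comb_frob x (s : nat) :
  comb x ^+ (q ^ (2 * s)) = \sum_k iota (x 0 k) * e k ^+ (q ^ (2 * s)).
Proof.
rewrite -/(frob_pow (pchar_extension (2 * s)) (comb x)) rmorph_sum; apply: eq_bigr => k _.
by rewrite rmorphM /= /frob_pow memE_frob.
Qed.

(* A relation between the columns of the Moore matrix is a polynomial of degree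
   less than q ^ (2m) that vanishes on the whole of L. *)
Lemma moore_unit : moore \in unitmx.
Proof.
rewrite -unitmx_tr -row_free_unit; apply: inj_row_free => v vM.
pose p : {poly LL} := \sum_(s < m) v 0 s *: 'X^(q ^ (2 * s)).
have root_p y : root p y.
  apply/rootP; rewrite -[y]coordsK; set x := coords y.
  rewrite horner_sum.
  transitivity (\sum_s \sum_k v 0 s * (iota (x 0 k) * e k ^+ (q ^ (2 * s)))).
    apply: eq_bigr => s _; rewrite hornerZ hornerXn.
    by rewrite -mulr_sumr -comb_frob.
  rewrite exchange_big big1 // => k _.
  have /rowP/(_ k) := vM; rewrite !mxE => vk.
  transitivity (iota (x 0 k) * \sum_j v 0 j * moore^T j k).
    by rewrite mulr_sumr; apply: eq_bigr => s _; rewrite !mxE mulrCA.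
  by rewrite vk mulr0.
have p0 : p = 0.
  apply/eqP; apply: contraT => p0; have := card_root_set p0.
  rewrite (eq_card (B := LL)); last by move=> y; rewrite inE root_p.
  rewrite card_extension leqNgt (leq_ltn_trans _ (_ : q ^ (2 * m).-1 < _)%N) //; last first.
    by rewrite ltn_exp2l //; lia.
  rewrite -ltnS (leq_ltn_trans (leq_pred _)) // ltnS.
  apply: leq_trans (size_sum _ _ _) _; apply/bigmax_leqP => s _.
  apply: leq_trans (size_scale_leq _ _) _; rewrite size_polyXn ltn_exp2l //.
  by have := ltn_ord s; lia.
apply/rowP=> s; have /polyP/(_ (q ^ (2 * s))%N) := p0.
rewrite coef0 coef_sum (bigD1 s) //= coefZ coefXn eqxx mulr1 big1 ?addr0.
  by move=> ->; rewrite mxE.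
move=> i is_; rewrite coefZ coefXn eqn_exp2l // eqn_pmul2l //.
by rewrite eq_sym val_eqE (negbTE is_) mulr0.
Qed.

Let g := invmx moore.

(** The powers y^(q^(2s)) form the coordinate row times the Moore matrix, because Frobenius by q^2
    fixes K; inverting the matrix recovers the coordinates. *)
Lemma coords_frob y l :
  iota (coords y 0 l) = \sum_(s < m) y ^+ (q ^ (2 * s)) * g s l.
Proof.
have -> : iota (coords y 0 l) = ((\row_k iota (coords y 0 k)) *m (moore *m g)) 0 l.
  by rewrite mulmxV ?moore_unit // mulmx1 mxE.
rewrite mulmxA mxE; apply: eq_bigr => s _; congr (_ * _).
rewrite -[in RHS](coordsK y) comb_frob mxE; apply: eq_bigr => k _.
by rewrite !mxE.
Qed.

Let hL := map_poly (in_alg L) (E_check q m z).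

Lemma root_check u : u \in Gamma q m -> root hL (z ^- u).
Proof.
move=> uG; rewrite /hL /E_check rmorphM rootM /= rmorph_prod.
rewrite (big_rem u) //= rootM (_ : map_poly _ _ = minPoly 1 (z ^- u)) ?root_minPoly //.
exact: map_base_minPoly.
Qed.

Lemma root_check_frob u k : root hL (z ^- u) -> root hL (z ^- (u * q ^ k)).
Proof.
by move=> ru; rewrite exprM -exprVn; have := root_map_frob_pow k ru; rewrite hq.
Qed.

Lemma root_check0 : root hL (z ^- 0).
Proof.
rewrite expr0 invr1 /hL /E_check rmorphM rootM; apply/orP; right.
by rewrite rmorphB /= map_polyX rmorph1 rootE !hornerE subrr.
Qed.

Lemma root_check_pow k : root hL (z ^- (q ^ k)).
Proof.
by rewrite -[(q ^ k)%N]mul1n root_check_frob // root_check // mem_head.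
Qed.

Lemma root_check_odd b : odd b -> (b < m)%N -> root hL (z ^- (q ^ b + 1)).
Proof.
move=> bo bm; apply: root_check; rewrite inE; apply/orP; right.
(* Here b = 2i - 1; since m is even, b < m gives i at most m/2. *)
apply/mapP; exists (b.+1)./2.
  rewrite mem_iota; apply/andP; split; first by case: b bo {bm}.
  have := odd_double_half m; rewrite (negbTE m_even) add0n => mE.
  rewrite add1n ltnS -leq_double mE -[(_./2).*2]add0n.
  have := odd_double_half b.+1; rewrite /= bo /= add0n => ->; exact: bm.
congr (q ^ _ + 1)%N; have := odd_double_half b.+1; rewrite /= bo /= add0n -mul2n => ->.
by rewrite subn1.
Qed.

(* An odd gap b > m is replaced by 2m - b, since z ^ (q ^ (2m)) = z. *)
Lemma root_check_pair a b : odd (a + b) -> (a < 2 * m)%N -> (b < 2 * m)%N ->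
  root hL (z ^- (q ^ a + q ^ b)).
Proof.
wlog ab : a b / (a <= b)%N.
  move=> H; have [/H//|/ltnW ba] := leqP a b.
  by rewrite addnC [(q ^ a + _)%N]addnC => ? ? ?; exact: H.
move=> oab am bm; pose c := (b - a)%N.
have bE : b = (a + c)%N by rewrite subnKC.
have oc : odd c by move: oab; rewrite bE addnA addnn oddD odd_double.
have [cm|mc] := ltnP c m.
  have -> : (q ^ a + q ^ b = (q ^ c + 1) * q ^ a)%N.
    by rewrite mulnDl mul1n -expnD addnC bE [(c + a)%N]addnC.
  exact/root_check_frob/root_check_odd.
pose c' := (2 * m - c)%N.
have cm : (m < c)%N.
  by rewrite ltn_neqAle mc andbT; apply: contra m_even => /eqP->.
have oc' : odd c' by rewrite oddB ?oddM ?oc //; lia.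
have -> : z ^- (q ^ a + q ^ b) = z ^- ((q ^ c' + 1) * q ^ b).
  congr (_^-1); rewrite mulnDl mul1n -expnD !exprD; congr (_ * _).
  have -> : (c' + b = a + 2 * m)%N by rewrite /c' bE; lia.
  by rewrite expnD mulnC exprM exp_cardL.
by apply/root_check_frob/root_check_odd; rewrite // /c'; lia.
Qed.

Local Notation killed := (killed n z hL).

Lemma killed_monomial u : root hL (z ^- u) -> killed (fun y => y ^+ u).
Proof. exact: killed_pow n_gt0 generator_expn _. Qed.

Lemma killed_coord k (a : L) : killed (fun y => iota (coords y 0 k) * a).
Proof.
apply: (@killed_ext _ _ _ _ (fun y => \sum_(s < m) (y ^+ (q ^ (2 * s)) * (g s k * a)))).
  by move=> y; rewrite coords_frob mulr_suml; apply: eq_bigr => s _; rewrite mulrA.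
apply: killed_sum => s; apply/killedZ/killed_monomial; exact: root_check_pow.
Qed.

Lemma coords_frob_conj y l :
  iota (coords y 0 l) ^+ q = \sum_(s < m) y ^+ (q ^ (2 * s + 1)) * g s l ^+ q.
Proof.
have charLq : [pchar L].-nat q by have := pchar_extension 1; rewrite expn1.
rewrite coords_frob -/(frob_pow charLq _) rmorph_sum; apply: eq_bigr => s _.
by rewrite rmorphM /= /frob_pow -exprM addn1 expnSr.
Qed.

Lemma killed_coord_conj k (a : L) : killed (fun y => iota (coords y 0 k) ^+ q * a).
Proof.
apply: (@killed_ext _ _ _ _
  (fun y => \sum_(s < m) (y ^+ (q ^ (2 * s + 1)) * (g s k ^+ q * a)))).
  by move=> y; rewrite coords_frob_conj mulr_suml; apply: eq_bigr => s _; rewrite mulrA.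
apply: killed_sum => s; apply/killedZ/killed_monomial; exact: root_check_pow.
Qed.

(** The product expands into y^(q^(2s) + q^(2s'+1)), whose two inner exponents have odd sum, as
    [root_check_pair] requires. *)
Lemma killed_coord_pair k l (a : L) :
  killed (fun y => iota (coords y 0 k) * iota (coords y 0 l) ^+ q * a).
Proof.
apply: (@killed_ext _ _ _ _ (fun y => \sum_(s < m) \sum_(s' < m)
   (y ^+ (q ^ (2 * s) + q ^ (2 * s' + 1)) * (g s k * g s' l ^+ q * a)))).
  move=> y; rewrite coords_frob coords_frob_conj big_distrlr /= mulr_suml.
  apply: eq_bigr => s _; rewrite mulr_suml; apply: eq_bigr => s' _.
  by rewrite exprD; ring.
apply: killed_sum => s; apply: killed_sum => s'; apply/killedZ/killed_monomial.
apply: root_check_pair; first by rewrite addn1 addnS /= oddD !mul2n !odd_double.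
  by rewrite ltn_pmul2l.
by apply: (@leq_trans (2 * s'.+1)); rewrite ?leq_pmul2l // mulnS addn1.
Qed.

Lemma iota_hval (A : 'M[K]_m) v c x : iota (hval conj A v c x) =
  \sum_l \sum_k iota (x 0 k) * iota (x 0 l) ^+ q * iota (A k l)
  + \sum_l (iota (x 0 l) * iota (conj (v 0 l)) + iota (x 0 l) ^+ q * iota (v 0 l))
  + iota c.
Proof.
have tr0 : tr conj 0 = 0 by rewrite /tr (rmorph0 conj) addr0.
rewrite /hval 2!(rmorphD iota); congr (_ + _ + _).
  rewrite /herm_form /scal mxE (rmorph_sum iota); apply: eq_bigr => l _.
  rewrite mxE (rmorphM iota) (rmorph_sum iota) mulr_suml; apply: eq_bigr => k _.
  by rewrite !mxE (rmorphM iota) conj_powE (rmorphXn iota) mulrAC.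
rewrite /scal mxE (big_morph (tr conj) (trD conj) tr0) (rmorph_sum iota).
apply: eq_bigr => l _; rewrite !mxE /tr (rmorphD iota) (rmorphM conj).
by rewrite (conjK card_subfield conj_powE) !(rmorphM iota) (conj_powE (x 0 l)) (rmorphXn iota).
Qed.

Lemma killed_hval A v c : killed (fun y => iota (hval conj A v c (coords y))).
Proof.
apply: (killed_ext (fun y => esym (iota_hval A v c (coords y)))).
apply: killedD; first apply: killedD.
- by apply: killed_sum => l; apply: killed_sum => k; exact: killed_coord_pair.
- apply: killed_sum => l; apply: killedD; first exact: killed_coord.
  exact: killed_coord_conj.
apply: (@killed_ext _ _ _ _ (fun y => y ^+ 0 * iota c)).
  by move=> y; rewrite expr0 mul1r.
by apply/killedZ/killed_monomial; exact: root_check0.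
Qed.

Local Notation realK := (real_set conj).
Local Notation herm := (hermmx conj).

(** The default 0 only occurs outside the real elements, which are those coming from F. *)
Definition to_base (y : K) : F := odflt 0 [pick a | in_alg L a == iota y].

Lemma to_baseK y : y \in realK -> in_alg L (to_base y) = iota y.
Proof.
move=> /real_setP yR; rewrite /to_base; case: pickP => [a /eqP //|no].
have : iota y \in 1%AS.
  rewrite Fermat's_little_theorem dimv1 expn1 hq; apply/eqP.
  by rewrite -[in RHS]yR conj_powE (rmorphXn iota).
by case/vlineP=> a ya; have := no a; rewrite /= ya eqxx.
Qed.

Lemma to_base_eq a b : a \in realK -> b \in realK -> (to_base a == to_base b) = (a == b).
Proof.
move=> aR bR; apply/eqP/eqP => [ab|-> //]; apply: (fmorph_inj iota).
by rewrite -!to_baseK // ab.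
Qed.

Definition point (i : 'I_n) : 'rV[K]_m := coords (z ^+ i).

Lemma point_neq0 i : point i != 0.
Proof. by rewrite -comb_eq0 coordsK expf_neq0 // generator_neq0. Qed.

Lemma point_onto x : x != 0 -> exists i, point i = x.
Proof.
rewrite -comb_eq0 => /powers_onto[i iE]; exists i.
by rewrite /point iE combK.
Qed.

(** The n indices reach all q^(2m) - 1 = n nonzero vectors, so none is repeated. *)
Lemma point_inj : injective point.
Proof.
suff /imset_injP inj : #|[set point i | i in 'I_n]| == #|'I_n|.
  by move=> i j; exact: inj.
rewrite eqn_leq leq_imset_card card_ord /=.
apply: leq_trans (_ : #|[set~ (0%R : 'rV[K]_m)]| <= _)%N.
  by rewrite cardsC1 card_mx mul1n card_subfield -expnM /n subn1.
apply/subset_leq_card/subsetP=> x; rewrite !inE => /point_onto[i <-].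
by rewrite imset_f.
Qed.

Lemma card_point (P : pred 'rV[K]_m) :
  #|[set i | P (point i)]| = #|[set x | (x != 0) && P x]|.
Proof.
rewrite -(card_imset _ point_inj); apply: eq_card => x; rewrite inE.
apply/imsetP/andP => [[i]|[/point_onto[i <-] Px]].
  by rewrite inE => Pi ->; rewrite point_neq0.
by exists i; rewrite // inE.
Qed.

Definition word (A : 'M[K]_m) (v : 'rV[K]_m) (c : K) : 'rV[F]_n :=
  \row_i to_base (hval conj A v c (point i)).

Lemma word_annihilated A v c : herm A -> c \in realK ->
  word A v c \in annihilated n (E_check q m z).
Proof.
move=> hA cR; rewrite inE -(dvdp_map (in_alg L)) rmorphB /= map_polyXn rmorph1 rmorphM /=.
have -> : map_poly (in_alg L) (rVpoly (word A v c)) =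
    word_poly n z (fun y => iota (hval conj A v c (coords y))).
  apply/polyP=> i; rewrite coef_map coef_rVpoly coef_poly /=; case: insubP => [j ji|].
    move=> jE; rewrite ji mxE -[LHS]/(in_alg L _) to_baseK -?jE //.
    exact: (hval_real card_subfield conj_powE).
  by move=> /negbTE->; rewrite scale0r.
exact: killed_hval.
Qed.

(** Values subtract with the triples, so distances are weights of difference triples. *)
Lemma hamming_dist_word A v c A' v' c' :
    herm A -> herm A' -> c \in realK -> c' \in realK ->
  hamming_dist (word A v c) (word A' v' c') = hweight conj (A - A') (v - v') (c - c').
Proof.
move=> hA hA' cR cR'; rewrite /hamming_dist /hweight.
rewrite -(card_point (fun x => hval conj (A - A') (v - v') (c - c') x != 0)).
apply: eq_card => i; rewrite !inE !mxE to_base_eq ?(hval_real card_subfield conj_powE) //.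
by rewrite hvalB subr_eq0.
Qed.

Lemma hamming_weight_word A v c : herm A -> c \in realK ->
  hamming_weight (word A v c) = hweight conj A v c.
Proof.
move=> hA cR; rewrite /hamming_weight /hweight.
rewrite -(card_point (fun x => hval conj A v c x != 0)).
apply: eq_card => i; rewrite !inE !mxE.
have -> : (0 : F) = to_base 0.
  apply: (fmorph_inj (in_alg L)).
  by apply: etrans (esym (to_baseK (real_set0 conj))); rewrite !rmorph0.
by rewrite to_base_eq ?real_set0 // (hval_real card_subfield conj_powE).
Qed.

Definition triples : {set 'M[K]_m * 'rV[K]_m * K} :=
  [set t | herm t.1.1 && (t.2 \in realK)].

Lemma triplesE t : (t \in triples) = herm t.1.1 && (t.2 \in realK).
Proof. by rewrite inE. Qed.

Definition tword (t : 'M[K]_m * 'rV[K]_m * K) := word t.1.1 t.1.2 t.2.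

Lemma card_triples : #|triples| = (q ^ (m ^ 2 + 2 * m + 1))%N.
Proof.
have -> : triples = setX (setX [set A | herm A] setT) realK.
  by apply/setP=> [[[A v] c]]; rewrite !inE /= andbT.
rewrite !cardsX (card_herm card_subfield conj_powE) (card_real card_subfield conj_powE).
rewrite cardsT card_mx.
by rewrite mul1n card_subfield -expnM -expnD -expnSr addn1.
Qed.

Let d := (q ^ (2 * m - 2) * (q ^ 2 - q - 1) - 1)%N.

(** Makes distinct triples give distinct words. As m is at least 2, q^(2m-2) > 1, which matters at q
    = 2, where q^2 - q - 1 = 1. *)
Let d_gt0 : (0 < d)%N.
Proof.
have : (1 < q ^ (2 * m - 2))%N.
  by rewrite -(expn0 q) ltn_exp2l //; case: m m_gt0 m_even => [|[|k]] //; lia.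
by rewrite /d -mulnn; move: (q ^ _)%N => B; move: q1 => q1' B1; nia.
Qed.

Lemma herm_sub (A A' : 'M[K]_m) : herm A -> herm A' -> herm (A - A').
Proof. by move=> /eqP hA /eqP hA'; rewrite /hermmx adjD adjN hA hA'. Qed.

Lemma dist_word_ge t t' : t \in triples -> t' \in triples -> t != t' ->
  (d <= hamming_dist (tword t) (tword t'))%N.
Proof.
case: t t' => [[A v] c] [[A' v'] c']; rewrite !triplesE /= => /andP[hA cR] /andP[hA' cR'] tt'.
have cB : c - c' \in realK by rewrite real_setD ?real_setN.
have nz : (A - A', v - v', c - c') != (0, 0, 0).
  by apply: contra tt'; rewrite !xpair_eqE !subr_eq0.
have ge := hweight_ge card_subfield conj_powE m_gt0 (herm_sub hA hA') cB nz.
rewrite /tword (hamming_dist_word v v' hA hA' cR cR'); exact: ge.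
Qed.

Lemma tword_inj : {in triples &, injective tword}.
Proof.
move=> t t' tT tT' ett; apply/eqP; apply: contraT => tt'.
have := dist_word_ge tT tT' tt'; rewrite leqNgt => /negP[].
rewrite ett (_ : hamming_dist _ _ = 0%N) //; apply: eq_card0 => i.
by rewrite inE eqxx.
Qed.

(** Each of the m/2 + 1 minimal polynomials has degree at most 2m, and x - 1 adds one: (m/2 + 1) 2m
    + 1 = m^2 + 2m + 1. *)
Lemma size_check : (size (E_check q m z) <= (m ^ 2 + 2 * m + 1).+1)%N.
Proof.
have szm (x : L) : (size (base_minPoly x) <= (2 * m).+1)%N.
  have -> : size (base_minPoly x) = size (minPoly 1 x).
    by rewrite -map_base_minPoly size_map_poly.
  rewrite size_minPoly ltnS.
  rewrite adjoin_degreeE dimv1 divn1 -dimL. exact: (dimvS (subvf <<1; x>>%VS)).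
have := size_prod_seq_leq_const (Gamma q m) (fun u => szm (z ^- u)).
rewrite /= size_map size_iota /E_check => szp.
apply: leq_trans (size_polyMleq _ _) _; rewrite size_XsubC.
rewrite addn2 /=; apply: leq_ltn_trans szp _.
have := odd_double_half m; rewrite (negbTE m_even) add0n -mul2n => mE.
by rewrite -{2 3 4}mE -mulnn; nia.
Qed.

Lemma monic_check : E_check q m z \is monic.
Proof.
rewrite /E_check monicMr ?monicXsubC //; apply: monic_prod => u _.
by rewrite -(map_monic (in_alg L)) map_base_minPoly monic_minPoly.
Qed.

(** The number of distinct annihilated words meets the bound set by the degree of the check
    polynomial. *)
Lemma code_is_words :
  [/\ E_check q m z %| 'X^n - 1,
      E_code q m z =i [set tword t | t in triples]
    & #|[set tword t | t in triples]| = (#|F| ^ (m ^ 2 + 2 * m + 1))%N].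
Proof.
have cW : (#|F| ^ (m ^ 2 + 2 * m + 1) <= #|[set tword t | t in triples]|)%N.
  by rewrite (card_in_imset tword_inj) card_triples hq.
have sW : [set tword t | t in triples] \subset annihilated n (E_check q m z).
  apply/subsetP=> w /imsetP[t]; rewrite triplesE => /andP[hA cR] ->.
  exact: word_annihilated.
exact: (cyclic_ideal_of_annihilated n_gt0 monic_check size_check cW sW).
Qed.

Lemma weight_countE w :
  (weight_count (E_code q m z) w)%:R = listed_count (weight_entries q m) w.
Proof.
have [_ eE _] := code_is_words.
(* The indicator of weight w turns the general weight sum into a count. *)
pose G (k : int) : rat := (k == w%:Z)%:R.
transitivity (\sum_(e <- weight_entries q m) G e.1 * e.2); last first.
  rewrite /listed_count [RHS]big_mkcond; apply: eq_bigr => a _.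
  by rewrite /G; case: eqP; rewrite ?mul1r ?mul0r.
rewrite -(sum_all_weights card_subfield conj_powE) //.
pose S := [set t in triples | hweight conj t.1.1 t.1.2 t.2 == w].
have -> : weight_count (E_code q m z) w = #|S|.
  rewrite /weight_count -(card_in_imset (f := tword) (D := S)); last first.
    move=> t t'; rewrite [t \in _]inE [t' \in _]inE => /andP[? _] /andP[? _].
    exact: tword_inj.
  apply: eq_card => x; rewrite inE eE; apply/andP/imsetP => [[/imsetP[t tT ->] wt]|].
    exists t => //; rewrite inE tT /=; move: tT; rewrite triplesE => /andP[hA cR].
    by rewrite -hamming_weight_word.
  case=> t; rewrite inE => /andP[tT wt] ->; split; first exact: imset_f.
  by move: tT; rewrite triplesE => /andP[hA cR]; rewrite hamming_weight_word.
rewrite -sum1_card natr_sum.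
under [in RHS]eq_bigr => A _ do rewrite pair_big_dep /=.
rewrite pair_big_dep /= [LHS]big_mkcond [RHS]big_mkcond /=.
rewrite (reindex (fun p : 'M[K]_m * ('rV[K]_m * K) => (p.1, p.2.1, p.2.2))) /=; last first.
  by exists (fun t => (t.1.1, (t.1.2, t.2))) => [[? [? ?]]|[[? ?] ?]].
apply: eq_bigr => -[A [v c]] _; rewrite !inE /= /G eqz_nat.
by case: (herm A && _) => //=; case: eqP.
Qed.

Lemma code_parameters : code_dim_dist (E_code q m z) (m ^ 2 + 2 * m + 1) d.
Proof.
have [_ eE cW] := code_is_words; split.
  have := card_code (E_code q m z).
  rewrite (eq_card (B := [set tword t | t in triples])); last first.
    by move=> x; rewrite inE eE.
  by rewrite cW => /eqP; rewrite eqn_exp2l ?finNzRing_gt1 // => /eqP.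
have [A [v [c [hA cR nz wE]]]] := hweight_attained card_subfield conj_powE m_gt0.
have tT : (A, v, c) \in triples by rewrite triplesE /= hA.
have oT : (0, 0, 0) \in triples.
  by rewrite triplesE /= real_set0 /hermmx adj0 eqxx.
split=> [|x y].
  (* The distance to the zero word is the minimum weight. *)
  exists (tword (A, v, c)), (tword (0, 0, 0)).
  rewrite !eE !imset_f //; split=> //.
    by apply: contra nz => /eqP/tword_inj->.
  move: oT; rewrite triplesE => /andP[h0 r0].
  by rewrite /tword (hamming_dist_word v 0 hA h0 cR r0) !subr0; exact: wE.
rewrite !eE => /imsetP[t tT' ->] /imsetP[t' tT'' ->] ne.
by apply: dist_word_ge => //; apply: contra ne => /eqP->.
Qed.

End Basis.

End ExtensionField.

Theorem mainTheorem3 (q m : nat) (F : finFieldType) (L : fieldExtType F) (pi : L)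
    (hq : #|F| = q) (hm0 : (0 < m)%N) (hm : ~~ odd m)
    (hL : \dim {:L} = (2 * m)%N) (hpi : generates_units pi) :
  let E := E_code q m pi in
  [/\ cyclic_code_with_check E (E_check q m pi),
      code_dim_dist E (m ^ 2 + 2 * m + 1)
        (q ^ (2 * m - 2) * (q ^ 2 - q - 1) - 1)
    & forall w : nat,
        (weight_count E w)%:R = listed_count (weight_entries q m) w].
Proof.
have [K dimK] := quadratic_subfield hm0 hL.
have [e e_onto] := basis_exists hL dimK.
split; [|exact: (code_parameters hq hm0 hm hL hpi dimK e_onto)
        |exact: (weight_countE hq hm0 hm hL hpi dimK e_onto)].
have [dv _ _] := code_is_words hq hm0 hm hL hpi dimK e_onto.
exists (('X^(q ^ (2 * m) - 1) - 1) %/ E_check q m pi); split=> //; last by rewrite divpK.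
(* The quotient is monic because the check polynomial and X^n - 1 are, the latter since n > 0. *)
rewrite -(monicMr _ (monic_check q m pi)) divpK // monicXnsubC //.
rewrite subn_gt0 -hq (leq_trans (finNzRing_gt1 F)) // -{1}[#|F|]expn1.
by rewrite leq_pexp2l ?muln_gt0 // ltnW ?finNzRing_gt1.
Qed.
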